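(* The sets $$\mathcal{UTOUR}=\{\mathbf f\in\mathcal G_0^{\mathbb N}:U[\mathbf f]\text{ is a universal tournament}\},$$ $$\mathcal{UGEN}=\{\mathbf f\in\mathcal{UTOUR}:\{i,f_1,f_2,\dots\}\text{ is linearly independent}\},$$ $$\mathcal{UGEN}^+=\{\mathbf f\in\mathcal{UTOUR}:\{f_1^e,f_2^e,\dots\}\text{ is linearly independent}\}$$ are dense $G_\delta$ subsets of $\mathcal G_0^{\mathbb N}$.
   Context: $\mathcal G$ is the group of strictly increasing continuous maps $f:[-1,1]\to[-1,1]$ with $f(\pm1)=\pm1$, topologized by the sup norm; $i$ is the identity; $\mathcal G_0=\{f\in\mathcal G:\int_{-1}^1f=0\}$; $\mathcal G_0^{\mathbb N}$ carries the product topology. $f^e(t)=\tfrac12(f(t)+f(-t))$; $Q(f,g)=\int_{-1}^1 f(g^{-1}(t))\,dt$. For $\mathbf f=(f_1,f_2,\dots)\in\mathcal G_0^{\mathbb N}$, $U[\mathbf f]$ is the digraph on $\mathbb N$ with $i\to j$ iff $Q(f_j,f_i)>0$. A tournament $(T,U)$ is universal if for every tournament $R$ on a countable set $S$, every finite $S_0\subset S$ and every embedding $\phi:R\cap(S_0\times S_0)\to U$ (injective, $i\to j$ iff $\phi(i)\to\phi(j)$), there is an embedding $\psi:R\to U$ extending $\phi$. *)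

(* Defs.v *)
From Stdlib Require Import Reals Lra ClassicalEpsilon.
From Coquelicot Require Import Coquelicot.
Open Scope R_scope.

(* Elements of the group G are represented as functions R -> R; only their
   values on [-1,1] matter. *)
Definition in_I (t : R) : Prop := -1 <= t <= 1.

Definition cont_on_I (f : R -> R) : Prop :=
  forall x, in_I x -> forall eps, 0 < eps -> exists delta, 0 < delta /\
    forall y, in_I y -> Rabs (y - x) < delta -> Rabs (f y - f x) < eps.

Definition inG (f : R -> R) : Prop :=
  (forall x y, in_I x -> in_I y -> x < y -> f x < f y) /\
  cont_on_I f /\
  (forall x, in_I x -> in_I (f x)) /\
  f (-1) = -1 /\ f 1 = 1.

Definition inG0 (f : R -> R) : Prop := inG f /\ RInt f (-1) 1 = 0.

Definition Ginv (g : R -> R) (t : R) : R :=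
  epsilon (inhabits 0) (fun s => in_I s /\ g s = t).

Definition Q (f g : R -> R) : R := RInt (fun t => f (Ginv g t)) (-1) 1.

Definition evenpart (f : R -> R) : R -> R := fun t => (f t + f (- t)) / 2.

Definition G0seq (F : nat -> R -> R) : Prop := forall n, inG0 (F n).

Definition Udig (F : nat -> R -> R) (i j : nat) : Prop := Q (F j) (F i) > 0.

Definition is_tournament {T : Type} (E : T -> T -> Prop) : Prop :=
  (forall x, ~ E x x) /\
  (forall x y, x <> y -> E x y \/ E y x) /\
  (forall x y, E x y -> ~ E y x).

Definition universal_prop {T : Type} (U : T -> T -> Prop) : Prop :=
  forall (S : Type) (Rl : S -> S -> Prop),
    (exists enc : S -> nat, forall x y, enc x = enc y -> x = y) ->
    is_tournament Rl ->
    forall (S0 : list S) (phi : S -> T),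
      (forall x y, List.In x S0 -> List.In y S0 -> phi x = phi y -> x = y) ->
      (forall x y, List.In x S0 -> List.In y S0 -> (Rl x y <-> U (phi x) (phi y))) ->
      exists psi : S -> T,
        (forall x y, psi x = psi y -> x = y) /\
        (forall x y, Rl x y <-> U (psi x) (psi y)) /\
        (forall x, List.In x S0 -> psi x = phi x).

Definition universal_tournament {T : Type} (U : T -> T -> Prop) : Prop :=
  is_tournament U /\ universal_prop U.

Definition lin_indep_I (h : nat -> R -> R) : Prop :=
  forall (n : nat) (c : nat -> R),
    (forall t, in_I t -> sum_f_R0 (fun k => c k * h k t) n = 0) ->
    forall k, (k <= n)%nat -> c k = 0.

Definition UTOUR (F : nat -> R -> R) : Prop :=
  G0seq F /\ universal_tournament (Udig F).

Definition UGEN (F : nat -> R -> R) : Prop :=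
  UTOUR F /\
  lin_indep_I (fun k => match k with O => (fun t => t) | S m => F m end).

Definition UGENplus (F : nat -> R -> R) : Prop :=
  UTOUR F /\ lin_indep_I (fun k => evenpart (F k)).

Definition supdist_lt (f g : R -> R) (eps : R) : Prop :=
  exists d, d < eps /\ forall t, in_I t -> Rabs (f t - g t) <= d.

Definition nbhd (F : nat -> R -> R) (N : nat) (eps : R) (F' : nat -> R -> R) : Prop :=
  forall k, (k < N)%nat -> supdist_lt (F k) (F' k) eps.

Definition open_G0N (A : (nat -> R -> R) -> Prop) : Prop :=
  forall F, G0seq F -> A F ->
    exists N eps, 0 < eps /\ forall F', G0seq F' -> nbhd F N eps F' -> A F'.

Definition dense_G0N (A : (nat -> R -> R) -> Prop) : Prop :=
  forall F, G0seq F -> forall N eps, 0 < eps ->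
    exists F', G0seq F' /\ nbhd F N eps F' /\ A F'.

Definition Gdelta_G0N (A : (nat -> R -> R) -> Prop) : Prop :=
  (forall F, A F -> G0seq F) /\
  exists B : nat -> (nat -> R -> R) -> Prop,
    (forall n, open_G0N (B n)) /\
    (forall F, G0seq F -> (A F <-> forall n, B n F)).

Definition dense_Gdelta_G0N (A : (nat -> R -> R) -> Prop) : Prop :=
  dense_G0N A /\ Gdelta_G0N A.

(* Main.v *)
Require Import Defs.
From Stdlib Require Import Reals Lra Lia ClassicalEpsilon Classical Arith List Cantor.
From Coquelicot Require Import Coquelicot.

(* [Q] is antisymmetric (Young's equality for inverse functions) and Lipschitz in its
   first argument, hence continuous. A tournament on [nat] is universal iff every
   finite set of vertices with prescribed arrow directions is joined to some vertex in
   that way; each such condition, and each finite linear independence, is open, which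
   gives the G_delta property.

   [UGENplus] is contained in the other two sets, so only its density matters. One
   builds a nearby sequence term by term. Since [Q(i, f_j) = 0], the map
   [i + delta u] has [Q(i + delta u, f_j) = - delta int u' f_j]; when the even parts of
   [f_0, ..., f_(n-1)] are independent, so are [1, i, f_0, ..., f_(n-1)], and these
   numbers can be given arbitrary signs. A convex combination of the term to be
   approximated with such a map makes all [Q(g, f_j)] nonzero (with prescribed signs if
   that term is [i]), and a further small even perturbation makes the even part of [g]
   independent of the previous ones. *)

(** * Continuity relative to [-1,1] *)

Definition clamp (t : R) : R := Rmax (-1) (Rmin 1 t).

Lemma clamp_in_I t : in_I (clamp t).
Proof. unfold in_I, clamp, Rmax, Rmin; repeat destruct Rle_dec; lra. Qed.

Lemma clamp_id t : in_I t -> clamp t = t.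
Proof. unfold in_I, clamp, Rmax, Rmin; repeat destruct Rle_dec; lra. Qed.

Lemma clamp_lip x y : Rabs (clamp y - clamp x) <= Rabs (y - x).
Proof.
  unfold clamp, Rmax, Rmin, Rabs; repeat destruct Rle_dec; repeat destruct Rcase_abs; lra.
Qed.

(** Composing with the 1-Lipschitz retraction [clamp] extends [f] continuously from [-1,1] to the
    whole line, where results on two-sided continuity and integrals apply. *)
Lemma continuous_clamp f x : cont_on_I f -> continuous (fun t => f (clamp t)) x.
Proof.
  intros Hf. apply continuity_pt_filterlim. intros eps Heps.
  destruct (Hf (clamp x) (clamp_in_I x) eps Heps) as [d [Hd H]].
  exists d; split; [exact Hd|]. intros y [_ Hy].
  apply H; [apply clamp_in_I|].
  eapply Rle_lt_trans; [apply clamp_lip|exact Hy].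
Qed.

Lemma continuous_cont_on_I f : (forall x, in_I x -> continuous f x) -> cont_on_I f.
Proof.
  intros Hf x Hx eps Heps.
  pose proof (proj2 (continuity_pt_filterlim f x) (Hf x Hx)) as H.
  destruct (H eps Heps) as [d [Hd H']]. exists d; split; [exact Hd|].
  (* [continuity_pt] speaks only of points other than [x]. *)
  intros y _ Hxy. destruct (Req_dec x y) as [<-|Hne].
  - unfold Rminus; rewrite Rplus_opp_r, Rabs_R0; exact Heps.
  - apply H'. split; [split; [exact I|exact Hne]|exact Hxy].
Qed.

Lemma cont_on_I_ext f g : (forall t, in_I t -> f t = g t) -> cont_on_I f -> cont_on_I g.
Proof.
  intros E Hf x Hx eps Heps. destruct (Hf x Hx eps Heps) as [d [Hd H]].
  exists d; split; [exact Hd|]. intros y Hy Hyx. rewrite <- !E by assumption; auto.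
Qed.

Lemma cont_on_I_unclamp f : (forall x, continuous (fun t => f (clamp t)) x) -> cont_on_I f.
Proof.
  intros H. apply (cont_on_I_ext (fun t => f (clamp t))).
  - intros t Ht; rewrite clamp_id; auto.
  - apply continuous_cont_on_I; auto.
Qed.

Lemma cont_on_I_const c : cont_on_I (fun _ => c).
Proof. apply continuous_cont_on_I; intros; apply continuous_const. Qed.

Lemma cont_on_I_id : cont_on_I (fun t => t).
Proof. apply continuous_cont_on_I; intros; apply continuous_id. Qed.

Lemma cont_on_I_plus f g : cont_on_I f -> cont_on_I g -> cont_on_I (fun t => f t + g t).
Proof.
  intros Hf Hg. apply cont_on_I_unclamp; intros x.
  apply (continuous_plus (fun t => f (clamp t)) (fun t => g (clamp t)));
    apply continuous_clamp; assumption.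
Qed.

Lemma cont_on_I_mult f g : cont_on_I f -> cont_on_I g -> cont_on_I (fun t => f t * g t).
Proof.
  intros Hf Hg. apply cont_on_I_unclamp; intros x.
  apply (continuous_mult (fun t => f (clamp t)) (fun t => g (clamp t)));
    apply continuous_clamp; assumption.
Qed.

Lemma cont_on_I_scal c f : cont_on_I f -> cont_on_I (fun t => c * f t).
Proof. intros; apply (cont_on_I_mult (fun _ => c)); [apply cont_on_I_const|assumption]. Qed.

Ltac cont_I :=
  intros; repeat first
    [ assumption | apply cont_on_I_const | apply cont_on_I_id
    | apply cont_on_I_plus | apply cont_on_I_scal | apply cont_on_I_mult | solve [auto] ].

Lemma cont_on_I_comp f g :
  cont_on_I f -> cont_on_I g -> (forall x, in_I x -> in_I (g x)) -> cont_on_I (fun t => f (g t)).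
Proof.
  intros Hf Hg HI x Hx eps Heps.
  destruct (Hf (g x) (HI x Hx) eps Heps) as [d [Hd H]].
  destruct (Hg x Hx d Hd) as [d' [Hd' H']].
  exists d'; split; [exact Hd'|]. auto.
Qed.

Lemma cont_on_I_lip L f :
  (forall x y, in_I x -> in_I y -> Rabs (f y - f x) <= L * Rabs (y - x)) -> cont_on_I f.
Proof.
  intros HL x Hx eps Heps.
  (* [L] may be zero or negative; [Rmax L 1] is a positive Lipschitz constant. *)
  assert (HM : 0 < Rmax L 1) by (unfold Rmax; destruct Rle_dec; lra).
  exists (eps / Rmax L 1); split; [apply Rdiv_lt_0_compat; assumption|].
  intros y Hy Hxy. apply Rle_lt_trans with (1 := HL x y Hx Hy).
  apply Rle_lt_trans with (Rmax L 1 * Rabs (y - x)).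
  - apply Rmult_le_compat_r; [apply Rabs_pos|apply Rmax_l].
  - apply (Rmult_lt_compat_l (Rmax L 1)) in Hxy; [|exact HM].
    replace (Rmax L 1 * (eps / Rmax L 1)) with eps in Hxy by (field; lra). exact Hxy.
Qed.

Lemma cont_on_I_bounded f :
  cont_on_I f -> exists M, 0 < M /\ forall t, in_I t -> Rabs (f t) <= M.
Proof.
  intros Hf.
  destruct (continuity_ab_maj (fun t => Rabs (f (clamp t))) (-1) 1) as [m [Hm _]]; [lra| |].
  - intros c _. apply continuity_pt_filterlim.
    apply (continuous_comp (fun t => f (clamp t)) Rabs).
    + apply continuous_clamp, Hf.
    + apply continuous_Rabs.
  - exists (Rabs (f (clamp m)) + 1); split.
    + pose proof (Rabs_pos (f (clamp m))); lra.
    + intros t Ht. specialize (Hm t Ht). cbv beta in Hm. rewrite (clamp_id t Ht) in Hm. lra.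
Qed.

Lemma ex_RInt_I f a b : cont_on_I f -> in_I a -> in_I b -> ex_RInt f a b.
Proof.
  intros Hf Ha Hb. apply ex_RInt_ext with (fun t => f (clamp t)).
  - intros x Hx. rewrite clamp_id; [reflexivity|].
    unfold in_I, Rmin, Rmax in *; repeat destruct Rle_dec; lra.
  - apply (ex_RInt_continuous (V := R_CompleteNormedModule)); intros; apply continuous_clamp, Hf.
Qed.

Lemma in_I_m1 : in_I (-1). Proof. unfold in_I; lra. Qed.
Lemma in_I_1 : in_I 1. Proof. unfold in_I; lra. Qed.
Lemma in_I_opp t : in_I t -> in_I (- t). Proof. unfold in_I; lra. Qed.
#[local] Hint Resolve in_I_m1 in_I_1 in_I_opp clamp_in_I : core.

(** * The integral over [-1,1] *)

Definition Int (f : R -> R) : R := RInt f (-1) 1.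

Lemma Int_ext f g : (forall t, in_I t -> f t = g t) -> Int f = Int g.
Proof.
  intros H. apply RInt_ext. intros x. unfold Rmin, Rmax; destruct Rle_dec; [|lra].
  intros Hx. apply H. unfold in_I; lra.
Qed.

Lemma Int_plus f g : cont_on_I f -> cont_on_I g -> Int (fun t => f t + g t) = Int f + Int g.
Proof. intros. apply (RInt_plus f g); apply ex_RInt_I; auto. Qed.

Lemma Int_scal c f : cont_on_I f -> Int (fun t => c * f t) = c * Int f.
Proof. intros. apply (RInt_scal f); apply ex_RInt_I; auto. Qed.

Lemma Int_const c : Int (fun _ => c) = 2 * c.
Proof. unfold Int; rewrite RInt_const. unfold scal; simpl; unfold mult; simpl. ring. Qed.

Lemma Int_id : Int (fun t => t) = 0.
Proof.
  replace 0 with ((fun t => t ^ 2 / 2) 1 - (fun t => t ^ 2 / 2) (-1)) by (simpl; field).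
  apply is_RInt_unique. apply (is_RInt_derive (fun t => t ^ 2 / 2)).
  - intros. auto_derive; [exact I|]. simpl; field.
  - intros. apply continuous_id.
Qed.

Lemma RInt_le_const f a b M :
  cont_on_I f -> in_I a -> in_I b -> a <= b -> (forall t, a <= t <= b -> f t <= M) ->
  RInt f a b <= (b - a) * M.
Proof.
  intros Hf Ha Hb Hab H.
  replace ((b - a) * M) with (RInt (fun _ => M) a b).
  - apply RInt_le; [exact Hab|apply ex_RInt_I; auto|apply ex_RInt_const|].
    intros; apply H; lra.
  - rewrite RInt_const. reflexivity.
Qed.

Lemma RInt_ge_const f a b M :
  cont_on_I f -> in_I a -> in_I b -> a <= b -> (forall t, a <= t <= b -> M <= f t) ->
  (b - a) * M <= RInt f a b.
Proof.
  intros Hf Ha Hb Hab H.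
  replace ((b - a) * M) with (RInt (fun _ => M) a b).
  - apply RInt_le; [exact Hab|apply ex_RInt_const|apply ex_RInt_I; auto|].
    intros; apply H; lra.
  - rewrite RInt_const. reflexivity.
Qed.

Lemma Int_abs_le f M : cont_on_I f -> (forall t, in_I t -> Rabs (f t) <= M) -> Rabs (Int f) <= 2 * M.
Proof.
  intros Hf H. apply Rabs_le. split.
  - replace (- (2 * M)) with ((1 - -1) * - M) by ring.
    apply RInt_ge_const; auto; [lra|]. intros t Ht. specialize (H t Ht).
    apply Rabs_le_between in H; lra.
  - replace (2 * M) with ((1 - -1) * M) by ring.
    apply RInt_le_const; auto; [lra|]. intros t Ht. specialize (H t Ht).
    apply Rabs_le_between in H; lra.
Qed.

Lemma RInt_Chasles_I f a b c :
  cont_on_I f -> in_I a -> in_I b -> in_I c -> RInt f a c = RInt f a b + RInt f b c.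
Proof. intros. symmetry. apply (RInt_Chasles f); apply ex_RInt_I; auto. Qed.

(** By continuity [f] exceeds [f t0 / 2] near [t0]. That neighbourhood, cut to [-1,1], keeps
    positive length even if [t0] is an end point. *)
Lemma Int_pos f t0 :
  cont_on_I f -> (forall t, in_I t -> 0 <= f t) -> in_I t0 -> 0 < f t0 -> 0 < Int f.
Proof.
  intros Hf Hpos Ht0 H0.
  destruct (Hf t0 Ht0 (f t0 / 2) ltac:(lra)) as [d [Hd H]].
  set (a := Rmax (-1) (t0 - d / 2)). set (b := Rmin 1 (t0 + d / 2)).
  assert (Ha : in_I a /\ in_I b /\ a < b /\ t0 - d / 2 <= a /\ b <= t0 + d / 2).
  { unfold a, b, in_I, Rmax, Rmin in *; repeat destruct Rle_dec; lra. }
  destruct Ha as [Ha [Hb [Hab [Ha' Hb']]]].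
  unfold Int; rewrite (RInt_Chasles_I f (-1) a 1), (RInt_Chasles_I f a b 1) by auto.
  assert (H1 : (a - -1) * 0 <= RInt f (-1) a).
  { apply RInt_ge_const; auto; [apply Ha|]. intros; apply Hpos; unfold in_I in *; lra. }
  assert (H2 : (1 - b) * 0 <= RInt f b 1).
  { apply RInt_ge_const; auto; [apply Hb|]. intros; apply Hpos; unfold in_I in *; lra. }
  assert (H3 : (b - a) * (f t0 / 2) <= RInt f a b).
  { apply RInt_ge_const; auto; [lra|]. intros t Ht.
    assert (Hx : Rabs (f t - f t0) < f t0 / 2).
    { apply H; [unfold in_I in *; lra|]. apply Rabs_lt_between; lra. }
    apply Rabs_lt_between in Hx; lra. }
  assert (0 < (b - a) * (f t0 / 2)) by (apply Rmult_lt_0_compat; lra).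
  lra.
Qed.

(** * The group G and antisymmetry of Q *)

Lemma inG_cont f : inG f -> cont_on_I f.
Proof. intros H; apply H. Qed.

Lemma inG_I f t : inG f -> in_I t -> in_I (f t).
Proof. intros (_ & _ & H & _); apply H. Qed.

Lemma inG_id : inG (fun t => t).
Proof. repeat split; auto using cont_on_I_id; unfold in_I in *; lra. Qed.

Lemma inG_le f x y : inG f -> in_I x -> in_I y -> x <= y -> f x <= f y.
Proof.
  intros Hf Hx Hy [H| <-]; [|lra]. left; apply Hf; auto.
Qed.

Lemma inG_inj f x y : inG f -> in_I x -> in_I y -> f x = f y -> x = y.
Proof.
  intros Hf Hx Hy E. destruct (Rtotal_order x y) as [H|[H|H]]; [|exact H|].
  - apply Hf in H; auto; lra.
  - apply Hf in H; auto; lra.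
Qed.

Lemma inG_surj f t : inG f -> in_I t -> exists s, in_I s /\ f s = t.
Proof.
  intros Hf Ht. pose proof Hf as (_ & Hc & _ & E1 & E2).
  (* [IVT] asks for strict signs at both ends, so the values -1 and 1 are treated apart. *)
  destruct (Req_dec t (-1)) as [->|N1]; [exists (-1); auto|].
  destruct (Req_dec t 1) as [->|N2]; [exists 1; auto|].
  destruct (IVT (fun s => f (clamp s) - t) (-1) 1) as [s [Hs E]].
  - intros x. apply continuity_pt_filterlim.
    apply (continuous_minus (fun s => f (clamp s)) (fun _ => t)).
    + apply continuous_clamp, Hc.
    + apply continuous_const.
  - lra.
  - cbv beta; rewrite clamp_id by auto. unfold in_I in Ht; lra.
  - cbv beta; rewrite clamp_id by auto. unfold in_I in Ht; lra.
  - exists s; split; [exact Hs|]. cbv beta in E; rewrite clamp_id in E by exact Hs. lra.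
Qed.

Lemma Ginv_spec g t : inG g -> in_I t -> in_I (Ginv g t) /\ g (Ginv g t) = t.
Proof.
  intros Hg Ht. unfold Ginv.
  apply (epsilon_spec (inhabits 0) (fun s => in_I s /\ g s = t)), inG_surj; auto.
Qed.

Lemma Ginv_left g s : inG g -> in_I s -> Ginv g (g s) = s.
Proof.
  intros Hg Hs. destruct (Ginv_spec g (g s) Hg (inG_I g s Hg Hs)) as [H1 H2].
  apply (inG_inj g); auto.
Qed.

Lemma Ginv_unique g s t : inG g -> in_I s -> g s = t -> Ginv g t = s.
Proof. intros Hg Hs <-. apply Ginv_left; auto. Qed.

(** A monotone map can only jump, and surjectivity excludes gaps: preimages of [f x - eps / 2] and
    [f x + eps / 2] bound a suitable neighbourhood of [x]. A value outside [-1,1] imposes no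
    constraint on its side. *)
Lemma increasing_onto_cont f :
  (forall x y, in_I x -> in_I y -> x < y -> f x < f y) ->
  (forall x, in_I x -> in_I (f x)) ->
  (forall t, in_I t -> exists s, in_I s /\ f s = t) -> cont_on_I f.
Proof.
  intros Hinc HI Hsurj x Hx eps Heps.
  assert (Hinv : forall a b, in_I a -> in_I b -> f a < f b -> a < b).
  { intros a b Ha Hb Hab. destruct (Rlt_le_dec a b) as [|[H|H]]; auto.
    - apply Hinc in H; auto; lra.
    - subst; lra. }
  assert (Hlo : exists d, 0 < d /\ forall y, in_I y -> x - d < y -> f x - eps < f y).
  { destruct (Rle_lt_dec (f x - eps / 2) (-1)) as [Hc|Hc].
    - exists 1; split; [lra|]. intros y Hy _. specialize (HI y Hy); unfold in_I in HI; lra.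
    - pose proof (HI x Hx) as Hfx. unfold in_I in Hfx.
      destruct (Hsurj (f x - eps / 2)) as [a [Ha Ea]]; [unfold in_I; lra|].
      assert (a < x) by (apply Hinv; auto; lra).
      exists (x - a); split; [lra|]. intros y Hy Hxy.
      assert (f a < f y) by (apply Hinc; auto; lra). lra. }
  assert (Hhi : exists d, 0 < d /\ forall y, in_I y -> y < x + d -> f y < f x + eps).
  { destruct (Rle_lt_dec 1 (f x + eps / 2)) as [Hc|Hc].
    - exists 1; split; [lra|]. intros y Hy _. specialize (HI y Hy); unfold in_I in HI; lra.
    - pose proof (HI x Hx) as Hfx. unfold in_I in Hfx.
      destruct (Hsurj (f x + eps / 2)) as [a [Ha Ea]]; [unfold in_I; lra|].
      assert (x < a) by (apply Hinv; auto; lra).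
      exists (a - x); split; [lra|]. intros y Hy Hxy.
      assert (f y < f a) by (apply Hinc; auto; lra). lra. }
  destruct Hlo as [d1 [Hd1 H1]], Hhi as [d2 [Hd2 H2]].
  exists (Rmin d1 d2); split; [apply Rmin_pos; auto|].
  intros y Hy Hxy. apply Rabs_lt_between in Hxy.
  pose proof (Rmin_l d1 d2). pose proof (Rmin_r d1 d2).
  specialize (H1 y Hy ltac:(lra)). specialize (H2 y Hy ltac:(lra)).
  apply Rabs_lt_between; lra.
Qed.

Lemma inG_Ginv g : inG g -> inG (Ginv g).
Proof.
  intros Hg. pose proof Hg as (Hinc & _ & HI & E1 & E2).
  assert (Hi : forall x y, in_I x -> in_I y -> x < y -> Ginv g x < Ginv g y).
  { intros x y Hx Hy Hxy. destruct (Ginv_spec g x Hg Hx) as [A1 B1].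
    destruct (Ginv_spec g y Hg Hy) as [A2 B2].
    destruct (Rlt_le_dec (Ginv g x) (Ginv g y)) as [|H]; auto.
    apply (inG_le g) in H; auto; lra. }
  assert (HI' : forall x, in_I x -> in_I (Ginv g x)) by (intros; apply Ginv_spec; auto).
  repeat split; auto.
  - apply increasing_onto_cont; auto. intros t Ht. exists (g t); split; auto.
    apply Ginv_left; auto.
  - apply HI'; auto.
  - apply HI'; auto.
  - apply Ginv_unique; auto.
  - apply Ginv_unique; auto.
Qed.

Lemma inG_comp f g : inG f -> inG g -> inG (fun t => f (g t)).
Proof.
  intros Hf Hg. pose proof Hf as (If & Cf & Jf & Lf & Uf). pose proof Hg as (Ig & Cg & Jg & Lg & Ug).
  split; [|split; [|split; [|split]]]; auto.
  - apply cont_on_I_comp; auto.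
  - rewrite Lg; auto.
  - rewrite Ug; auto.
Qed.

(* Young's equality without regularity: on each cell of a subdivision, the areas
   under [h] and under its inverse miss the increment of [x h(x)] by at most the
   area of a rectangle, and these rectangles add up to [4 / n]. *)
Lemma young_inverse h : inG h -> Int h + Int (Ginv h) = 0.
Proof.
  intros Hh. set (k := Ginv h). assert (Hk : inG k) by apply inG_Ginv, Hh.
  assert (Hcell : forall x y, in_I x -> in_I y -> x <= y ->
    Rabs (RInt h x y + RInt k (h x) (h y) - (y * h y - x * h x)) <= (y - x) * (h y - h x)).
  { intros x y Hx Hy Hxy. pose proof (inG_le h x y Hh Hx Hy Hxy) as Hle.
    pose proof (inG_I h x Hh Hx) as Ix. pose proof (inG_I h y Hh Hy) as Iy.
    assert (A1 : (y - x) * h x <= RInt h x y).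
    { apply RInt_ge_const; auto using inG_cont. intros; apply inG_le; auto; unfold in_I in *; lra. }
    assert (A2 : RInt h x y <= (y - x) * h y).
    { apply RInt_le_const; auto using inG_cont. intros; apply inG_le; auto; unfold in_I in *; lra. }
    assert (A3 : (h y - h x) * x <= RInt k (h x) (h y)).
    { apply RInt_ge_const; auto using inG_cont. intros t Ht.
      rewrite <- (Ginv_left h x) by auto. apply inG_le; auto; unfold in_I in *; lra. }
    assert (A4 : RInt k (h x) (h y) <= (h y - h x) * y).
    { apply RInt_le_const; auto using inG_cont. intros t Ht.
      rewrite <- (Ginv_left h y) by auto. apply inG_le; auto; unfold in_I in *; lra. }
    apply Rabs_le. lra. }
  assert (Hn : forall n, Rabs (Int h + Int k) <= 4 / INR (S n)).
  { intros n. assert (HN : 0 < INR (S n)) by (apply lt_0_INR; lia).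
    (* Uniform subdivision into [S n] cells. *)
    set (p := fun i => -1 + 2 / INR (S n) * INR i).
    assert (Hp : forall i, (i <= S n)%nat -> in_I (p i)).
    { intros i Hi. apply le_INR in Hi. unfold p, in_I.
      assert (0 <= 2 / INR (S n)) by (apply Rlt_le, Rdiv_lt_0_compat; lra).
      pose proof (pos_INR i). split.
      - assert (0 <= 2 / INR (S n) * INR i) by (apply Rmult_le_pos; auto). lra.
      - apply (Rmult_le_compat_l (2 / INR (S n))) in Hi; auto.
        replace (2 / INR (S n) * INR (S n)) with 2 in Hi by (field; lra). lra. }
    (* The cells telescope: the subtracted 1 is the value of [x * h x] at -1, and the error is the
       mesh times the rise of [h] so far. *)
    assert (Hind : forall i, (i <= S n)%nat ->
      Rabs (RInt h (-1) (p i) + RInt k (-1) (h (p i)) - (p i * h (p i) - 1))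
        <= 2 / INR (S n) * (h (p i) + 1)).
    { induction i as [|i IH]; intros Hi.
      - replace (p O) with (-1) by (unfold p; simpl; ring).
        replace (h (-1)) with (-1) by (symmetry; apply Hh).
        rewrite !RInt_point. unfold zero; simpl.
        replace (0 + 0 - (-1 * -1 - 1)) with 0 by ring. rewrite Rabs_R0; lra.
      - specialize (IH ltac:(lia)).
        assert (Ip := Hp i ltac:(lia)). assert (Is := Hp (S i) Hi).
        assert (Es : p (S i) - p i = 2 / INR (S n)) by (unfold p; rewrite (S_INR i); ring).
        assert (0 < 2 / INR (S n)) by (apply Rdiv_lt_0_compat; lra).
        specialize (Hcell _ _ Ip Is ltac:(lra)). rewrite Es in Hcell.
        rewrite (RInt_Chasles_I h (-1) (p i) (p (S i))),
          (RInt_Chasles_I k (-1) (h (p i)) (h (p (S i)))) by auto using inG_cont, inG_I.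
        apply Rabs_le_between in IH. apply Rabs_le_between in Hcell. apply Rabs_le. lra. }
    (* At the right end [x * h x] is again 1, so the boundary terms cancel and only the error
       remains. *)
    specialize (Hind (S n) (le_n _)).
    replace (p (S n)) with 1 in Hind by (unfold p; field; lra).
    replace (h 1) with 1 in Hind by (symmetry; apply Hh).
    replace (1 * 1 - 1) with 0 in Hind by ring. rewrite Rminus_0_r in Hind.
    replace (4 / INR (S n)) with (2 / INR (S n) * (1 + 1)) by (field; lra). exact Hind. }
  destruct (Req_dec (Int h + Int k) 0) as [|Hne]; auto. exfalso.
  set (a := Rabs (Int h + Int k)) in *.
  assert (Ha : 0 < a) by (apply Rabs_pos_lt, Hne).
  destruct (archimed_cor1 (a / 4)) as [n [Hn1 Hn2]]; [lra|].
  specialize (Hn (pred n)). replace (S (pred n)) with n in Hn by lia.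
  unfold Rdiv in Hn. lra.
Qed.

Lemma QE f g : Q f g = Int (fun t => f (Ginv g t)).
Proof. reflexivity. Qed.

(** Young's equality for the composite of [f] with the inverse of [g], whose inverse is the
    composite of [g] with the inverse of [f]. *)
Lemma Q_antisym f g : inG f -> inG g -> Q f g = - Q g f.
Proof.
  intros Hf Hg. rewrite !QE.
  pose proof (young_inverse (fun t => f (Ginv g t)) (inG_comp _ _ Hf (inG_Ginv _ Hg))) as H.
  rewrite (Int_ext (Ginv (fun t => f (Ginv g t))) (fun t => g (Ginv f t))) in H; [lra|].
  intros t Ht. destruct (Ginv_spec f t Hf Ht) as [A B].
  apply Ginv_unique; auto using inG_comp, inG_Ginv, inG_I.
  rewrite Ginv_left; auto.
Qed.

Lemma Q_diag f : inG f -> Q f f = 0.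
Proof. intros Hf. pose proof (Q_antisym f f Hf Hf). lra. Qed.

Lemma Q_id_r f : inG f -> Q f (fun t => t) = Int f.
Proof.
  intros Hf. apply Int_ext. intros t Ht. f_equal. apply Ginv_unique; auto using inG_id.
Qed.

(** This is where the zero mean enters: the identity ties with every member of [inG0], so small
    changes of the identity can decide each sign freely. *)
Lemma Q_id_l f : inG0 f -> Q (fun t => t) f = 0.
Proof.
  intros [Hf H0]. rewrite Q_antisym, Q_id_r by auto using inG_id. unfold Int; lra.
Qed.

Lemma cont_on_I_comp_Ginv f g : cont_on_I f -> inG g -> cont_on_I (fun t => f (Ginv g t)).
Proof.
  intros Hf Hg. apply cont_on_I_comp; auto.
  - apply inG_cont, inG_Ginv, Hg.
  - intros; apply Ginv_spec; auto.
Qed.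

(** * Linearity and continuity of [Q] *)

Lemma Q_lin a b f1 f2 g :
  cont_on_I f1 -> cont_on_I f2 -> inG g ->
  Q (fun t => a * f1 t + b * f2 t) g = a * Q f1 g + b * Q f2 g.
Proof.
  intros H1 H2 Hg. rewrite !QE.
  rewrite (Int_plus (fun t => a * f1 (Ginv g t)) (fun t => b * f2 (Ginv g t))),
    (Int_scal a (fun t => f1 (Ginv g t))), (Int_scal b (fun t => f2 (Ginv g t)));
    auto using cont_on_I_comp_Ginv, cont_on_I_scal.
Qed.

Lemma Q_lip_l f f' g d :
  cont_on_I f -> cont_on_I f' -> inG g -> (forall t, in_I t -> Rabs (f t - f' t) <= d) ->
  Rabs (Q f g - Q f' g) <= 2 * d.
Proof.
  intros H1 H2 Hg Hd.
  replace (Q f g - Q f' g) with (Q (fun t => 1 * f t + -1 * f' t) g)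
    by (rewrite Q_lin by auto; ring).
  apply Int_abs_le.
  - apply (cont_on_I_comp_Ginv (fun t => 1 * f t + -1 * f' t)); auto.
    apply cont_on_I_plus; apply cont_on_I_scal; auto.
  - intros t Ht. replace (1 * f (Ginv g t) + -1 * f' (Ginv g t))
      with (f (Ginv g t) - f' (Ginv g t)) by ring.
    apply Hd, Ginv_spec; auto.
Qed.

(* [Q] is Lipschitz in its second argument because it is in the first and is
   antisymmetric; no modulus of continuity of [f] enters. *)
Lemma Q_lip f f' g g' d :
  inG f -> inG f' -> inG g -> inG g' ->
  (forall t, in_I t -> Rabs (f t - f' t) <= d) ->
  (forall t, in_I t -> Rabs (g t - g' t) <= d) ->
  Rabs (Q f g - Q f' g') <= 4 * d.
Proof.
  intros Hf Hf' Hg Hg' H1 H2.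
  pose proof (Q_lip_l f f' g d (inG_cont _ Hf) (inG_cont _ Hf') Hg H1) as A.
  pose proof (Q_lip_l g g' f' d (inG_cont _ Hg) (inG_cont _ Hg') Hf' H2) as B.
  rewrite (Q_antisym g f'), (Q_antisym g' f') in B by auto.
  apply Rabs_le_between in A. apply Rabs_le_between in B. apply Rabs_le. lra.
Qed.

(** The substitution [t = p s] turns [Q f p] into the integral of [f] against [dp]; antisymmetry
    then exchanges the arguments. *)
Lemma Q_by_parts p dp f :
  inG p -> inG f -> (forall x, is_derive p x (dp x)) -> (forall x, continuous dp x) ->
  Q p f = - Int (fun s => dp s * f s).
Proof.
  intros Hp Hf Hd Hc. rewrite Q_antisym by auto. f_equal. unfold Q, Int.
  (* The substitution rule wants two-sided continuity at the end points as well, which [clamp]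
     provides. *)
  set (F := fun t => f (Ginv p (clamp t))).
  transitivity (RInt F (p (-1)) (p 1)).
  - replace (p (-1)) with (-1) by (symmetry; apply Hp).
    replace (p 1) with 1 by (symmetry; apply Hp).
    apply (Int_ext (fun t => f (Ginv p t))). intros t Ht. unfold F. rewrite clamp_id; auto.
  - rewrite <- (RInt_comp F p dp (-1) 1).
    + apply (Int_ext _ (fun s => dp s * f s)). intros t Ht. unfold scal; simpl; unfold mult; simpl.
      unfold F. rewrite clamp_id, Ginv_left by auto using inG_I. reflexivity.
    + intros x _. apply (continuous_clamp (fun t => f (Ginv p t))).
      apply cont_on_I_comp_Ginv; auto using inG_cont.
    + intros x _. split; auto.
Qed.

(** * Linear independence and dual families *)

(** Half-open sums, the empty one included; [sum_f_R0 a n] also counts the index [n]. *)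
Fixpoint lsum (n : nat) (a : nat -> R) : R :=
  match n with O => 0 | S m => lsum m a + a m end.

Lemma lsum_S_sum_f_R0 n a : lsum (S n) a = sum_f_R0 a n.
Proof. induction n as [|n IH]; [simpl; ring|]. simpl in *. rewrite IH. reflexivity. Qed.

Lemma lsum_ext n a b : (forall k, (k < n)%nat -> a k = b k) -> lsum n a = lsum n b.
Proof.
  induction n as [|n IH]; intros H; simpl; [reflexivity|].
  rewrite IH, (H n) by auto with arith. reflexivity.
Qed.

Lemma lsum_plus n a b : lsum n (fun k => a k + b k) = lsum n a + lsum n b.
Proof. induction n as [|n IH]; simpl; [ring|rewrite IH; ring]. Qed.

Lemma lsum_scal n x a : lsum n (fun k => x * a k) = x * lsum n a.
Proof. induction n as [|n IH]; simpl; [ring|rewrite IH; ring]. Qed.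

Lemma lsum_0 n a : (forall k, (k < n)%nat -> a k = 0) -> lsum n a = 0.
Proof.
  induction n as [|n IH]; intros H; simpl; [reflexivity|].
  rewrite IH, (H n) by auto with arith. ring.
Qed.

Lemma lsum_le n a b : (forall k, (k < n)%nat -> a k <= b k) -> lsum n a <= lsum n b.
Proof.
  induction n as [|n IH]; intros H; simpl; [lra|].
  specialize (IH ltac:(auto with arith)). specialize (H n ltac:(auto with arith)). lra.
Qed.

Lemma lsum_const n x : lsum n (fun _ => x) = INR n * x.
Proof. induction n as [|n IH]; [simpl; ring|]. rewrite S_INR; simpl. rewrite IH; ring. Qed.

Lemma lsum_delta n j a :
  (j < n)%nat -> lsum n (fun k => a k * (if Nat.eqb k j then 1 else 0)) = a j.
Proof.
  induction n as [|n IH]; intros Hj; [lia|]. simpl.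
  destruct (Nat.eqb_spec n j) as [->|Hne].
  - rewrite lsum_0; [ring|]. intros k Hk. destruct (Nat.eqb_spec k j); [lia|ring].
  - rewrite IH by lia. ring.
Qed.

Lemma lsum_abs n a : Rabs (lsum n a) <= lsum n (fun k => Rabs (a k)).
Proof.
  induction n as [|n IH]; simpl; [rewrite Rabs_R0; lra|].
  eapply Rle_trans; [apply Rabs_triang|]. lra.
Qed.

Lemma lsum_nonneg_0 n a :
  (forall k, (k < n)%nat -> 0 <= a k) -> lsum n a <= 0 -> forall k, (k < n)%nat -> a k = 0.
Proof.
  induction n as [|n IH]; intros Hp H k Hk; [lia|]. simpl in H.
  assert (0 <= lsum n a).
  { rewrite <- (lsum_0 n (fun _ => 0)) by auto. apply lsum_le; auto with arith. }
  pose proof (Hp n ltac:(auto with arith)).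
  destruct (Nat.eq_dec k n) as [->|]; [lra|]. apply IH; auto with arith; [lra|lia].
Qed.

Definition lc (a : nat -> R) (h : nat -> R -> R) (n : nat) (t : R) : R :=
  lsum n (fun k => a k * h k t).

Definition indep (h : nat -> R -> R) (n : nat) : Prop :=
  forall c, (forall t, in_I t -> lc c h n t = 0) -> forall k, (k < n)%nat -> c k = 0.

Lemma lin_indep_I_indep h : lin_indep_I h <-> forall n, indep h (S n).
Proof.
  split; intros H n c Hc k Hk; (apply (H n c); [|lia]); intros t Ht; rewrite <- (Hc t Ht).
  - unfold lc. rewrite lsum_S_sum_f_R0. reflexivity.
  - unfold lc. rewrite lsum_S_sum_f_R0. reflexivity.
Qed.

Lemma lc_ext a b h h' n t :
  (forall k, (k < n)%nat -> a k * h k t = b k * h' k t) -> lc a h n t = lc b h' n t.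
Proof. apply lsum_ext. Qed.

Lemma indep_ext h h' n :
  (forall k t, (k < n)%nat -> in_I t -> h k t = h' k t) -> indep h n -> indep h' n.
Proof.
  intros E H c Hc. apply H. intros t Ht. rewrite <- (Hc t Ht).
  apply lc_ext. intros k Hk. rewrite E; auto.
Qed.

Lemma indep_S_intro h n :
  indep h n ->
  (forall c, (forall t, in_I t -> lc c h (S n) t = 0) -> c n = 0) -> indep h (S n).
Proof.
  intros H1 H2 c Hc k Hk. pose proof (H2 c Hc) as Hn.
  destruct (Nat.eq_dec k n) as [->|Hne]; auto.
  apply (H1 c); [|lia]. intros t Ht. specialize (Hc t Ht).
  unfold lc in *; simpl in Hc. rewrite Hn in Hc. lra.
Qed.

Lemma indep_S h n : indep h (S n) -> indep h n.
Proof.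
  intros H c Hc k Hk.
  (* The coefficients are padded with 0 at index [n]. *)
  replace (c k) with (if Nat.ltb k n then c k else 0)
    by (destruct (Nat.ltb_spec k n); [reflexivity|lia]).
  apply (H (fun k => if Nat.ltb k n then c k else 0)); [|lia].
  intros t Ht. unfold lc; simpl. rewrite Nat.ltb_irrefl.
  rewrite Rmult_0_l, Rplus_0_r. etransitivity; [|exact (Hc t Ht)]. apply lsum_ext. intros j Hj.
  destruct (Nat.ltb_spec j n); [reflexivity|lia].
Qed.

Lemma lc_cont a h n : (forall k, (k < n)%nat -> cont_on_I (h k)) -> cont_on_I (lc a h n).
Proof.
  unfold lc; induction n as [|n IH]; intros H; simpl; [apply cont_on_I_const|].
  apply cont_on_I_plus; [apply IH|apply cont_on_I_scal]; auto with arith.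
Qed.

Lemma Int_lc_mult a h n g :
  (forall k, (k < n)%nat -> cont_on_I (h k)) -> cont_on_I g ->
  Int (fun t => lc a h n t * g t) = lsum n (fun k => a k * Int (fun t => h k t * g t)).
Proof.
  unfold lc; induction n as [|n IH]; intros H Hg; simpl.
  - rewrite (Int_ext _ (fun _ => 0)) by (intros; ring). rewrite Int_const; ring.
  - rewrite (Int_ext _ (fun t => lsum n (fun k => a k * h k t) * g t + a n * (h n t * g t)))
      by (intros; ring).
    assert (Hc : cont_on_I (h n)) by auto.
    assert (Cl : cont_on_I (fun t => lsum n (fun k => a k * h k t))) by (apply (lc_cont a h n); auto).
    rewrite Int_plus, Int_scal, IH by cont_I. reflexivity.
Qed.

Lemma Int_sq_pos w t0 :
  cont_on_I w -> in_I t0 -> w t0 <> 0 -> 0 < Int (fun t => w t * w t).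
Proof.
  intros Hw Ht0 H0. apply (Int_pos _ t0); auto using cont_on_I_mult.
  - intros; apply Rle_0_sqr.
  - apply Rsqr_pos_lt, H0.
Qed.

(* Gram-Schmidt: [w] is the component of [h m] orthogonal to [h 0, ..., h (m - 1)]. *)
Lemma indep_dual h m :
  (forall k, (k < m)%nat -> cont_on_I (h k)) -> indep h m ->
  forall c, exists a, forall j, (j < m)%nat -> Int (fun t => lc a h m t * h j t) = c j.
Proof.
  induction m as [|m IH]; intros Hc Hi c; [exists (fun _ => 0); lia|].
  assert (Hc' : forall k, (k < m)%nat -> cont_on_I (h k)) by auto.
  assert (Hm : cont_on_I (h m)) by auto.
  pose proof (IH Hc' (indep_S _ _ Hi)) as IH'.
  (* [b] gives the orthogonal projection of [h m] onto the span of the earlier members. *)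
  destruct (IH' (fun j => Int (fun t => h m t * h j t))) as [b Hb].
  set (w := fun t => h m t + -1 * lc b h m t).
  assert (Cb : cont_on_I (lc b h m)) by (apply lc_cont; auto).
  assert (Cw : cont_on_I w) by (apply cont_on_I_plus, cont_on_I_scal; auto).
  (* If [w] vanished, the coefficients 1 at [m] and [- b k] below it would contradict
     independence. *)
  assert (Hw : exists t0, in_I t0 /\ w t0 <> 0).
  { apply NNPP. intros Hno.
    assert (E : (if Nat.eqb m m then 1 else - b m) = 0).
    { apply (Hi (fun k => if Nat.eqb k m then 1 else - b k)); [|lia].
      intros t Ht. apply NNPP. intros Hne. apply Hno. exists t; split; auto.
      intros E. apply Hne. rewrite <- E. unfold w, lc; simpl. rewrite Nat.eqb_refl, <- lsum_scal.
      rewrite Rmult_1_l, Rplus_comm. f_equal. apply lsum_ext. intros k Hk.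
      destruct (Nat.eqb_spec k m); [lia|ring]. }
    rewrite Nat.eqb_refl in E. lra. }
  destruct Hw as [t0 [Ht0 Hw0]].
  assert (D0 := Int_sq_pos w t0 Cw Ht0 Hw0). set (D := Int (fun t => w t * w t)) in *.
  assert (Hort : forall j, (j < m)%nat -> Int (fun t => w t * h j t) = 0).
  { intros j Hj. unfold w.
    rewrite (Int_ext _ (fun t => h m t * h j t + -1 * (lc b h m t * h j t))) by (intros; ring).
    rewrite Int_plus, Int_scal, Hb by cont_I. ring. }
  (* [h m] is [w] plus its projection, and [w] is orthogonal to the projection. *)
  assert (Hdiag : Int (fun t => w t * h m t) = D).
  { rewrite (Int_ext _ (fun t => w t * w t + lc b h m t * w t)) by (intros; unfold w; ring).
    rewrite Int_plus, Int_lc_mult by cont_I.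
    rewrite lsum_0; [unfold D; ring|]. intros k Hk.
    rewrite (Int_ext _ (fun t => w t * h k t)), Hort; auto; [ring|]. intros; ring. }
  destruct (IH' c) as [a Ha].
  (* Adding [lam * w] corrects the integral against [h m] and, by orthogonality, leaves the earlier
     ones unchanged. *)
  set (lam := (c m - Int (fun t => lc a h m t * h m t)) / D).
  set (a' := fun k => if Nat.eqb k m then lam else a k - lam * b k).
  assert (Ca : cont_on_I (lc a h m)) by (apply lc_cont; auto).
  assert (El : forall t, lc a' h (S m) t = lc a h m t + lam * w t).
  { intros t. unfold lc, w; simpl. unfold a' at 2. rewrite Nat.eqb_refl.
    rewrite (lsum_ext m (fun k => a' k * h k t)
      (fun k => a k * h k t + - lam * (b k * h k t))).
    - rewrite lsum_plus, lsum_scal. unfold lc. ring.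
    - intros k Hk. unfold a'. destruct (Nat.eqb_spec k m); [lia|ring]. }
  exists a'. intros j Hj.
  rewrite (Int_ext _ (fun t => lc a h m t * h j t + lam * (w t * h j t)))
    by (intros; rewrite El; ring).
  assert (Cj : cont_on_I (h j)) by auto.
  rewrite Int_plus, Int_scal by cont_I.
  destruct (Nat.eq_dec j m) as [->|Hne].
  - rewrite Hdiag. unfold lam. field. lra.
  - rewrite Ha, Hort by lia. ring.
Qed.

Lemma finite_upper (m : nat) (P : nat -> R -> Prop) :
  (forall j x y, x <= y -> P j x -> P j y) ->
  (forall j, (j < m)%nat -> exists x, P j x) ->
  exists x, 0 < x /\ forall j, (j < m)%nat -> P j x.
Proof.
  intros Hmon. induction m as [|m IH]; intros H; [exists 1; split; [lra|lia]|].
  destruct IH as [x [Hx H1]]; [auto|]. destruct (H m) as [y Hy]; auto.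
  exists (Rmax x y); split; [apply Rlt_le_trans with x; auto using Rmax_l|].
  intros j Hj. destruct (Nat.eq_dec j m) as [->|Hne].
  - apply Hmon with y; auto using Rmax_r.
  - apply Hmon with x; auto using Rmax_l. apply H1; lia.
Qed.

(* Integrating a vanishing combination against a dual family recovers its
   coefficients up to an error proportional to their size. *)
Lemma indep_stable h m :
  (forall k, (k < m)%nat -> cont_on_I (h k)) -> indep h m ->
  exists eps, 0 < eps /\ forall h',
    (forall k, (k < m)%nat -> cont_on_I (h' k)) ->
    (forall k t, (k < m)%nat -> in_I t -> Rabs (h k t - h' k t) <= eps) -> indep h' m.
Proof.
  intros Hc Hi.
  (* [M] bounds all members of a dual family [v] at once. *)
  destruct (finite_upper m (fun j M => exists v, cont_on_I v /\
      (forall t, in_I t -> Rabs (v t) <= M) /\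
      forall k, (k < m)%nat -> Int (fun t => h k t * v t) = if Nat.eqb k j then 1 else 0))
    as [M [HM Hv]].
  - intros j x y Hxy (v & H1 & H2 & H3). exists v; repeat split; auto.
    intros t Ht. specialize (H2 t Ht); lra.
  - intros j Hj.
    destruct (indep_dual h m Hc Hi (fun k => if Nat.eqb k j then 1 else 0)) as [a Ha].
    assert (Ca : cont_on_I (lc a h m)) by (apply lc_cont; auto).
    destruct (cont_on_I_bounded _ Ca) as [M [_ HM]].
    exists M, (lc a h m); repeat split; auto.
    intros k Hk. rewrite <- (Ha k Hk). apply Int_ext; intros; ring.
  - assert (HN : 0 <= INR m) by apply pos_INR.
    (* With this choice the estimate of the coefficients becomes [s <= s / 2] for their absolute sum
       [s], which forces [s] to be 0. *)
    set (eps := / (4 * M * (INR m + 1))).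
    assert (Heps : 0 < eps).
    { apply Rinv_0_lt_compat. apply Rmult_lt_0_compat; lra. }
    exists eps; split; [exact Heps|]. intros h' Hc' Hd c Hz.
    set (s := lsum m (fun k => Rabs (c k))).
    assert (Hs : 0 <= s).
    { unfold s. rewrite <- (lsum_0 m (fun _ => 0)) by auto. apply lsum_le; intros; apply Rabs_pos. }
    assert (Hcj : forall j, (j < m)%nat -> Rabs (c j) <= 2 * (s * eps * M)).
    { intros j Hj. destruct (Hv j Hj) as (v & Cv & Bv & Dv).
      assert (E : c j = Int (fun t => lc c h m t * v t)).
      { rewrite Int_lc_mult by auto. rewrite (lsum_ext m _
          (fun k => c k * (if Nat.eqb k j then 1 else 0))).
        - rewrite lsum_delta; auto.
        - intros k Hk. rewrite Dv; auto. }
      rewrite E. apply Int_abs_le.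
      - apply cont_on_I_mult; auto. apply lc_cont; auto.
      - intros t Ht. rewrite Rabs_mult.
        apply Rmult_le_compat; auto using Rabs_pos.
        replace (lc c h m t) with (lsum m (fun k => c k * (h k t - h' k t))).
        + eapply Rle_trans; [apply lsum_abs|]. unfold s. rewrite Rmult_comm, <- lsum_scal.
          apply lsum_le. intros k Hk. rewrite Rabs_mult, Rmult_comm.
          apply Rmult_le_compat_r; auto using Rabs_pos.
        (* The combination of the [h' k] is zero, so subtracting it leaves only the differences
           [h k - h' k]. *)
        + replace (lc c h m t) with (lc c h m t + -1 * lc c h' m t) by (rewrite (Hz t Ht); ring).
          unfold lc. rewrite <- lsum_scal, <- lsum_plus. apply lsum_ext; intros; ring. }
    assert (Hle : s <= INR m * (2 * (s * eps * M))).
    { unfold s at 1. rewrite <- lsum_const. apply lsum_le; auto. }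
    assert (Ee : eps * M * (INR m + 1) = / 4).
    { unfold eps. field. split; lra. }
    assert (Hs0 : s <= 0).
    { assert (H0 : 0 <= eps * M) by (apply Rmult_le_pos; lra).
      assert (H1 : s * (INR m * (eps * M)) <= s * / 4).
      { apply Rmult_le_compat_l; auto. lra. }
      lra. }
    intros k Hk. assert (E : Rabs (c k) = 0).
    { apply (lsum_nonneg_0 m (fun k => Rabs (c k))); auto. intros; apply Rabs_pos. }
    destruct (Req_dec (c k) 0) as [|Hne]; auto. apply Rabs_no_R0 in Hne; lra.
Qed.

(** * Perturbations with prescribed signs *)

Lemma lsum_S_l n a : lsum (S n) a = a O + lsum n (fun k => a (S k)).
Proof.
  induction n as [|n IH]; [simpl; ring|].
  change (lsum (S n) a + a (S n) = a O + (lsum n (fun k => a (S k)) + a (S n))).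
  rewrite IH. ring.
Qed.

Lemma indep_tail h n : indep h (S n) -> indep (fun k => h (S k)) n.
Proof.
  intros H c Hc k Hk.
  apply (H (fun k => match k with O => 0 | S j => c j end)) with (k := S k); [|lia].
  intros t Ht. unfold lc. rewrite lsum_S_l. specialize (Hc t Ht). unfold lc in Hc. lra.
Qed.

Lemma inG_intro f :
  (forall x y, in_I x -> in_I y -> x < y -> f x < f y) -> cont_on_I f ->
  f (-1) = -1 -> f 1 = 1 -> inG f.
Proof.
  intros Hi Hc E1 E2. split; [|split; [|split]]; auto.
  intros x Hx. unfold in_I in *.
  destruct (Req_dec x (-1)) as [->|]; [lra|]. destruct (Req_dec x 1) as [->|]; [lra|].
  assert (f (-1) < f x) by (apply Hi; unfold in_I; lra).
  assert (f x < f 1) by (apply Hi; unfold in_I; lra). lra.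
Qed.

Lemma evenpart_cont f : cont_on_I f -> cont_on_I (evenpart f).
Proof.
  intros Hf. apply (cont_on_I_ext (fun t => / 2 * (f t + f (- t)))).
  - intros; unfold evenpart; field.
  - apply cont_on_I_scal, cont_on_I_plus; auto.
    apply (cont_on_I_comp f (fun t => - t)); auto.
    apply (cont_on_I_ext (fun t => -1 * t)); [intros; ring|]. cont_I.
Qed.

Lemma evenpart_1 f : inG f -> evenpart f 1 = 0.
Proof. intros (_ & _ & _ & E1 & E2). unfold evenpart.
  replace (- (1)) with (-1) by ring. rewrite E1, E2. field. Qed.

(** Constants and the identity are adjoined because a function orthogonal to both has a primitive
    that vanishes at both ends and has mean zero. *)
Definition with_affine (F : nat -> R -> R) (k : nat) : R -> R :=
  match k with O => fun _ => 1 | S O => fun t => t | S (S m) => F m end.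

(** The even part of a relation loses the term in [t]; at 1 all even parts vanish, which removes the
    constant. Independence of the even parts removes the [F k], and the original relation at 1
    removes the identity. *)
Lemma indep_with_affine F n :
  (forall k, (k < n)%nat -> inG (F k)) -> indep (fun k => evenpart (F k)) n ->
  indep (with_affine F) (S (S n)).
Proof.
  intros HF Hi c Hc.
  assert (E : forall t, in_I t -> c O + c 1%nat * t + lc (fun k => c (S (S k))) F n t = 0).
  { intros t Ht. rewrite <- (Hc t Ht). unfold lc. rewrite !lsum_S_l; simpl. ring. }
  assert (Ee : forall t, in_I t ->
    c O + lc (fun k => c (S (S k))) (fun k => evenpart (F k)) n t = 0).
  { intros t Ht. pose proof (E t Ht) as A. pose proof (E (- t) (in_I_opp t Ht)) as B.
    unfold lc in *.
    rewrite (lsum_ext n _ (fun k => / 2 * (c (S (S k)) * F k t) + / 2 * (c (S (S k)) * F k (- t))))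
      by (intros; unfold evenpart; field).
    rewrite lsum_plus, !lsum_scal. lra. }
  assert (E0 : c O = 0).
  { specialize (Ee 1 in_I_1). unfold lc in Ee. rewrite lsum_0 in Ee; [lra|].
    intros k Hk. rewrite evenpart_1 by auto. ring. }
  assert (E2 : forall k, (k < n)%nat -> c (S (S k)) = 0).
  { apply (Hi (fun k => c (S (S k)))). intros t Ht. specialize (Ee t Ht). lra. }
  assert (E1 : c 1%nat = 0).
  { specialize (E 1 in_I_1). unfold lc in E. rewrite lsum_0 in E; [lra|].
    intros k Hk. rewrite E2 by auto. ring. }
  intros [|[|k]] Hk; auto. apply E2. lia.
Qed.

(* Near the identity, [f -> Q(f, F j)] is linear to first order: for [p = i + delta u]
   one has [Q(p, F j) = - delta * int u' (F j)], and the values [int u' (F j)] can be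
   prescribed by a dual family. *)
Lemma exists_direction F n c :
  (forall k, (k < n)%nat -> inG0 (F k)) -> indep (fun k => evenpart (F k)) n ->
  exists p delta, 0 < delta /\ inG0 p /\
    (forall x y, in_I x -> in_I y -> x < y -> (y - x) / 2 <= p y - p x) /\
    forall j, (j < n)%nat -> Q p (F j) = delta * c j.
Proof.
  intros HF Hi.
  assert (HG : forall k, (k < n)%nat -> inG (F k)) by (intros; apply HF; auto).
  assert (Ch : forall k, (k < S (S n))%nat -> cont_on_I (with_affine F k)).
  { intros [|[|k]] Hk; simpl; [apply cont_on_I_const|apply cont_on_I_id|].
    apply inG_cont, HG; lia. }
  (* The minus sign offsets the one in [Q_by_parts]. *)
  destruct (indep_dual _ _ Ch (indep_with_affine F n HG Hi)
    (fun k => match k with S (S j) => - c j | _ => 0 end)) as [a Ha].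
  set (v := lc a (with_affine F) (S (S n))) in *.
  assert (Cv : cont_on_I v) by (apply lc_cont, Ch).
  assert (V1 : Int v = 0).
  { rewrite <- (Ha O) by lia. apply Int_ext; intros; simpl; ring. }
  assert (Vt : Int (fun t => v t * t) = 0) by (apply (Ha 1%nat); lia).
  assert (VF : forall j, (j < n)%nat -> Int (fun t => v t * F j t) = - c j).
  { intros j Hj. apply (Ha (S (S j))); lia. }
  destruct (cont_on_I_bounded v Cv) as [M [HM HvM]].
  (* The continuous extension makes the primitive differentiable on the whole line. *)
  set (vc := fun t => v (clamp t)).
  assert (Cvc : forall x, continuous vc x) by (intros; apply continuous_clamp, Cv).
  assert (Cvc' : cont_on_I vc) by (apply continuous_cont_on_I; auto).
  assert (Hvc : forall t, in_I t -> vc t = v t) by (intros; unfold vc; rewrite clamp_id; auto).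
  (* Then [delta * v] is at most 1/2 in absolute value, so the slope of [p] is at least 1/2. *)
  set (delta := / (2 * M)).
  assert (Hdelta : 0 < delta) by (apply Rinv_0_lt_compat; lra).
  assert (HdM : delta * M = / 2) by (unfold delta; field; lra).
  set (u := fun t => RInt vc (-1) t).
  set (p := fun t => t + delta * u t).
  set (dp := fun t => 1 + delta * vc t).
  assert (Hp : forall x, is_derive p x (dp x)).
  { intros x. apply (is_derive_plus (fun t => t) (fun t => delta * u t)).
    - apply (is_derive_id (K := R_AbsRing)).
    - apply (is_derive_scal u).
      apply (is_derive_RInt vc u (-1)).
      + exists (mkposreal 1 Rlt_0_1). intros y _. apply (RInt_correct vc).
        apply (ex_RInt_continuous (V := R_CompleteNormedModule)); auto.
      + apply Cvc. }
  assert (Cdp : forall x, continuous dp x).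
  { intros x. apply (continuous_plus (fun _ => 1) (fun t => delta * vc t)).
    - apply continuous_const.
    - apply (continuous_mult (fun _ => delta) vc); [apply continuous_const|apply Cvc]. }
  assert (Cp : cont_on_I p).
  { apply continuous_cont_on_I. intros x _. apply (ex_derive_continuous p).
    exists (dp x). apply Hp. }
  assert (Slope : forall x y, in_I x -> in_I y -> x < y -> (y - x) / 2 <= p y - p x).
  { intros x y Hx Hy Hxy. unfold p, u.
    rewrite (RInt_Chasles_I vc (-1) x y) by auto.
    assert (A : (y - x) * - M <= RInt vc x y).
    { apply RInt_ge_const; auto; [lra|]. intros t Ht. rewrite Hvc by (unfold in_I in *; lra).
      specialize (HvM t). apply Rabs_le_between in HvM; [lra|unfold in_I in *; lra]. }
    apply (Rmult_le_compat_l delta) in A; [|lra].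
    replace (delta * ((y - x) * - M)) with (- ((y - x) / 2)) in A
      by (transitivity (- ((y - x) * (delta * M))); [rewrite HdM; field|ring]).
    lra. }
  assert (Hpm : p (-1) = -1).
  { unfold p, u. rewrite RInt_point. unfold zero; simpl; ring. }
  assert (Hp1 : p 1 = 1).
  { unfold p, u. fold (Int vc). rewrite (Int_ext vc v) by exact Hvc. rewrite V1. ring. }
  assert (Gp : inG p).
  { apply inG_intro; auto. intros x y Hx Hy Hxy. specialize (Slope x y Hx Hy Hxy). lra. }
  assert (QF : forall f, inG f -> Q p f = - Int f - delta * Int (fun t => v t * f t)).
  { intros f Hf. assert (Cf := inG_cont f Hf).
    rewrite (Q_by_parts p dp f) by auto.
    rewrite (Int_ext _ (fun t => f t + delta * (v t * f t)))
      by (intros; unfold dp; rewrite Hvc by auto; ring).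
    rewrite Int_plus, Int_scal by cont_I. ring. }
  exists p, delta; split; [exact Hdelta|split; [split; [exact Gp|]|split; [exact Slope|]]].
  (* The mean of [p] is [Q] against the identity, and [v] is orthogonal to [t]. *)
  - change (Int p = 0). rewrite <- Q_id_r, QF, Vt, Int_id by auto using inG_id. ring.
  - intros j Hj. rewrite QF, VF by auto. destruct (HF j Hj) as [_ E]. unfold Int; rewrite E. ring.
Qed.

(** * Even bumps with disjoint supports *)

(** The admissible perturbations: a small multiple keeps a map with slope bounded below increasing,
    and the end values are unchanged. *)
Definition even_lip (w : R -> R) : Prop :=
  (exists L, forall x y, in_I x -> in_I y -> Rabs (w y - w x) <= L * Rabs (y - x)) /\
  w 1 = 0 /\ forall t, w (- t) = w t.

Definition disjoint_bumps (e : nat -> R -> R) : Prop :=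
  (forall j, even_lip (e j)) /\
  (forall j, exists t, in_I t /\ e j t <> 0) /\
  (forall i j t, i <> j -> e i t * e j t = 0).

Lemma even_lip_cont w : even_lip w -> cont_on_I w.
Proof. intros [[L HL] _]. apply (cont_on_I_lip L), HL. Qed.

Lemma even_lip_lin x y w1 w2 :
  even_lip w1 -> even_lip w2 -> even_lip (fun t => x * w1 t + y * w2 t).
Proof.
  intros [[L1 H1] [A1 B1]] [[L2 H2] [A2 B2]]. split; [|split].
  - exists (Rabs x * L1 + Rabs y * L2). intros s t Hs Ht.
    replace (x * w1 t + y * w2 t - (x * w1 s + y * w2 s))
      with (x * (w1 t - w1 s) + y * (w2 t - w2 s)) by ring.
    eapply Rle_trans; [apply Rabs_triang|]. rewrite !Rabs_mult.
    specialize (H1 s t Hs Ht). specialize (H2 s t Hs Ht).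
    apply (Rmult_le_compat_l (Rabs x)) in H1; [|apply Rabs_pos].
    apply (Rmult_le_compat_l (Rabs y)) in H2; [|apply Rabs_pos]. lra.
  - rewrite A1, A2; ring.
  - intros t. rewrite B1, B2; reflexivity.
Qed.

(** A tent over the interval from [a] to [b] in the variable [Rabs t], hence even. *)
Definition hat (a b t : R) : R := Rmax 0 (Rmin (Rabs t - a) (b - Rabs t)).

Lemma hat_even_lip a b : b <= 1 -> even_lip (hat a b).
Proof.
  intros Hb. unfold hat. split; [|split].
  - exists 1. intros x y _ _. rewrite Rmult_1_l.
    pose proof (Rabs_triang_inv y x) as H1. pose proof (Rabs_triang_inv x y) as H2.
    rewrite (Rabs_minus_sym x y) in H2.
    set (d := Rabs (y - x)) in *. set (X := Rabs x) in *. set (Y := Rabs y) in *.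
    apply Rabs_le. unfold Rmax, Rmin; repeat destruct Rle_dec; lra.
  - rewrite Rabs_R1. unfold Rmax, Rmin; repeat destruct Rle_dec; lra.
  - intros t. rewrite Rabs_Ropp. reflexivity.
Qed.

Lemma hat_support a b t : hat a b t <> 0 -> a < Rabs t < b.
Proof. unfold hat, Rmax, Rmin; repeat destruct Rle_dec; intros; lra. Qed.

Lemma exists_disjoint_bumps : exists e, disjoint_bumps e.
Proof.
  (* Consecutive reciprocals delimit infinitely many disjoint intervals inside (0,1). *)
  set (a := fun j => / INR (S j)).
  assert (Hdec : forall i j, (i <= j)%nat -> a j <= a i).
  { intros i j Hij. apply Rinv_le_contravar; [apply lt_0_INR; lia|apply le_INR; lia]. }
  assert (Hlt : forall j, a (S j) < a j).
  { intros j. apply Rinv_lt_contravar; [|apply lt_INR; lia].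
    apply Rmult_lt_0_compat; apply lt_0_INR; lia. }
  assert (Hpos : forall j, 0 < a j) by (intros; apply Rinv_0_lt_compat, lt_0_INR; lia).
  assert (H1 : forall j, a j <= 1).
  { intros j. replace 1 with (a O) by (unfold a; simpl; field). apply Hdec; lia. }
  exists (fun j => hat (a (S j)) (a j)). split; [|split].
  - intros j. apply hat_even_lip, H1.
  - intros j. specialize (Hlt j). specialize (H1 j). specialize (Hpos (S j)).
    exists ((a (S j) + a j) / 2). split; [unfold in_I; lra|].
    unfold hat. rewrite Rabs_right by lra.
    unfold Rmax, Rmin; repeat destruct Rle_dec; lra.
  - assert (Hsym : forall i j t, (i < j)%nat -> hat (a (S i)) (a i) t * hat (a (S j)) (a j) t = 0).
    { intros i j t Hij. apply NNPP; intros Hne.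
      assert (A : a (S i) < Rabs t < a i) by (apply hat_support; intros E; apply Hne; rewrite E; ring).
      assert (B : a (S j) < Rabs t < a j) by (apply hat_support; intros E; apply Hne; rewrite E; ring).
      specialize (Hdec (S i) j Hij). lra. }
    intros i j t Hij. destruct (Nat.lt_total i j) as [H|[H|H]]; [auto|lia|].
    rewrite Rmult_comm; auto.
Qed.

(* Each functional is killed by combining the bumps in consecutive pairs; the
   disjointness of the supports keeps the combinations nonzero. *)
Lemma bumps_orthogonal phi m :
  (forall k, (k < m)%nat -> cont_on_I (phi k)) ->
  exists e, disjoint_bumps e /\
    forall j k, (k < m)%nat -> Int (fun t => e j t * phi k t) = 0.
Proof.
  induction m as [|m IH]; intros Hphi.
  - destruct exists_disjoint_bumps as [e He]. exists e; split; auto; lia.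
  - destruct IH as [e [[He1 [He2 He3]] He4]]; auto.
    assert (Cm : cont_on_I (phi m)) by auto.
    set (I1 := fun j => Int (fun t => e (2 * j)%nat t * phi m t)).
    set (I2 := fun j => Int (fun t => e (2 * j + 1)%nat t * phi m t)).
    (* [x j] and [y j] form a nontrivial solution of [x * I1 j + y * I2 j = 0]. *)
    set (x := fun j => if Req_EM_T (I2 j) 0 then 0 else I2 j).
    set (y := fun j => if Req_EM_T (I2 j) 0 then 1 else - I1 j).
    set (e' := fun j t => x j * e (2 * j)%nat t + y j * e (2 * j + 1)%nat t).
    exists e'. split; [split; [|split]|].
    + intros j. apply even_lip_lin; auto.
    + intros j. destruct (Req_EM_T (I2 j) 0) as [E|E].
      * destruct (He2 (2 * j + 1)%nat) as [t [Ht Hne]]. exists t; split; auto.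
        unfold e', x, y. destruct (Req_EM_T (I2 j) 0); [|contradiction]. lra.
      * destruct (He2 (2 * j)%nat) as [t [Ht Hne]]. exists t; split; auto.
        assert (H0 : e (2 * j + 1)%nat t = 0).
        { assert (H := He3 (2 * j)%nat (2 * j + 1)%nat t ltac:(lia)).
          apply Rmult_integral in H. tauto. }
        unfold e', x, y. destruct (Req_EM_T (I2 j) 0); [contradiction|].
        rewrite H0, Rmult_0_r, Rplus_0_r. apply Rmult_integral_contrapositive; auto.
    + intros i j t Hij. unfold e'.
      transitivity
        (x i * x j * (e (2 * i)%nat t * e (2 * j)%nat t)
         + x i * y j * (e (2 * i)%nat t * e (2 * j + 1)%nat t)
         + y i * x j * (e (2 * i + 1)%nat t * e (2 * j)%nat t)
         + y i * y j * (e (2 * i + 1)%nat t * e (2 * j + 1)%nat t)); [ring|].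
      rewrite !He3 by lia. ring.
    + intros j k Hk.
      assert (C1 : cont_on_I (e (2 * j)%nat)) by apply even_lip_cont, He1.
      assert (C2 : cont_on_I (e (2 * j + 1)%nat)) by apply even_lip_cont, He1.
      assert (Ck : cont_on_I (phi k)) by auto.
      rewrite (Int_ext _ (fun t => x j * (e (2 * j)%nat t * phi k t)
        + y j * (e (2 * j + 1)%nat t * phi k t))) by (intros; unfold e'; ring).
      rewrite Int_plus, !Int_scal by cont_I.
      destruct (Nat.eq_dec k m) as [->|Hne].
      * fold (I1 j) (I2 j). unfold x, y. destruct (Req_EM_T (I2 j) 0) as [E|E]; [rewrite E|]; ring.
      * rewrite !He4 by lia. ring.
Qed.

Lemma finite_lower (m : nat) (P : nat -> R -> Prop) :
  (forall j x y, 0 < x <= y -> P j y -> P j x) ->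
  (forall j, (j < m)%nat -> exists x, 0 < x /\ P j x) ->
  exists x, 0 < x /\ forall j, (j < m)%nat -> P j x.
Proof.
  intros Hmon. induction m as [|m IH]; intros H; [exists 1; split; [lra|lia]|].
  destruct IH as [x [Hx H1]]; [auto|]. destruct (H m) as [y [Hy H2]]; auto.
  assert (Hmin : 0 < Rmin x y) by (apply Rmin_pos; auto).
  exists (Rmin x y); split; [exact Hmin|].
  intros j Hj. destruct (Nat.eq_dec j m) as [->|Hne].
  - apply Hmon with y; auto using Rmin_r.
  - apply Hmon with x; auto using Rmin_l. apply H1; lia.
Qed.

Definition extend (n : nat) (F : nat -> R -> R) (g : R -> R) (k : nat) : R -> R :=
  if Nat.eqb k n then g else F k.

Lemma extend_lt n F g k : (k < n)%nat -> extend n F g k = F k.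
Proof. intros H. unfold extend. destruct (Nat.eqb_spec k n); [lia|reflexivity]. Qed.

Lemma extend_eq n F g : extend n F g n = g.
Proof. unfold extend. rewrite Nat.eqb_refl. reflexivity. Qed.

Definition sgn (b : bool) : R := if b then 1 else -1.

(* Moving [h] towards a direction [p] with the prescribed signs leaves the sign of a
   nonzero [Q(h, F j)] alone and decides the sign when [Q(h, F j) = 0]. *)
Lemma perturb_signs F n h eps sigma :
  (forall k, (k < n)%nat -> inG0 (F k)) -> indep (fun k => evenpart (F k)) n ->
  inG0 h -> 0 < eps ->
  exists g s, 0 < s /\ inG0 g /\
    (forall t, in_I t -> Rabs (h t - g t) <= eps) /\
    (forall x y, in_I x -> in_I y -> x < y -> s * (y - x) <= g y - g x) /\
    forall j, (j < n)%nat ->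
      Q g (F j) <> 0 /\ (Q h (F j) = 0 -> 0 < sgn (sigma j) * Q g (F j)).
Proof.
  intros HF Hi Hh Heps.
  destruct (exists_direction F n (fun j => sgn (sigma j)) HF Hi) as (p & d & Hd & Hp & Sp & Qp).
  (* For weights up to [x] and 1/2, the contribution of [p] stays below half of each nonzero
     [Q h (F j)] and cannot cancel the share of [h]. *)
  destruct (finite_lower n (fun j x => Q h (F j) <> 0 -> x * d < Rabs (Q h (F j)) / 2))
    as [x [Hx Hxj]].
  - intros j x y [Hx Hxy] H Hne. specialize (H Hne).
    apply Rle_lt_trans with (2 := H). apply Rmult_le_compat_r; lra.
  - intros j Hj. destruct (Req_dec (Q h (F j)) 0) as [E|E].
    + exists 1; split; [lra|]. intros; contradiction.
    + assert (H : 0 < Rabs (Q h (F j))) by (apply Rabs_pos_lt, E).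
      exists (Rabs (Q h (F j)) / (4 * d)). split; [apply Rdiv_lt_0_compat; lra|]. intros _.
      replace (Rabs (Q h (F j)) / (4 * d) * d) with (Rabs (Q h (F j)) / 4) by (field; lra). lra.
  (* Two members of the group differ by at most 2, hence [eps / 2]. *)
  - set (s := Rmin x (Rmin (1 / 2) (eps / 2))).
    assert (Hs : 0 < s) by (repeat apply Rmin_pos; lra).
    assert (Hsx : s <= x /\ s <= 1 / 2 /\ s <= eps / 2).
    { unfold s, Rmin; repeat destruct Rle_dec; lra. }
    destruct Hsx as [Hs1 [Hs2 Hs3]].
    pose proof Hh as [Gh Ih]. pose proof Hp as [Gp Ip].
    assert (Ch := inG_cont h Gh). assert (Cp := inG_cont p Gp).
    set (g := fun t => (1 - s) * h t + s * p t).
    assert (Sg : forall a b, in_I a -> in_I b -> a < b -> s / 2 * (b - a) <= g b - g a).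
    { intros a b Ha Hb Hab. unfold g. specialize (Sp a b Ha Hb Hab).
      assert (h a < h b) by (apply Gh; auto).
      assert (0 <= (1 - s) * (h b - h a)) by (apply Rmult_le_pos; lra).
      apply (Rmult_le_compat_l s) in Sp; lra. }
    assert (Gg : inG g).
    { destruct Gh as (_ & _ & _ & Eh1 & Eh2). destruct Gp as (_ & _ & _ & Ep1 & Ep2).
      apply inG_intro.
      - intros a b Ha Hb Hab. specialize (Sg a b Ha Hb Hab).
        assert (0 < s / 2 * (b - a)) by (apply Rmult_lt_0_compat; lra). lra.
      - unfold g; cont_I.
      - unfold g; rewrite Eh1, Ep1; ring.
      - unfold g; rewrite Eh2, Ep2; ring. }
    exists g, (s / 2); split; [lra|split; [split; [exact Gg|]|split; [|split; [exact Sg|]]]].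
    + change (Int g = 0). unfold g. rewrite Int_plus, !Int_scal by cont_I.
      unfold Int; rewrite Ih, Ip; ring.
    + intros t Ht. pose proof (inG_I h t Gh Ht) as A. pose proof (inG_I p t Gp Ht) as B.
      unfold in_I in A, B.
      replace (h t - g t) with (s * (h t - p t)) by (unfold g; ring).
      rewrite Rabs_mult, (Rabs_right s) by lra.
      apply Rle_trans with (s * 2); [|lra].
      apply Rmult_le_compat_l; [lra|]. apply Rabs_le; lra.
    + intros j Hj. unfold g. rewrite (Q_lin (1 - s) s h p) by (auto; apply HF; auto).
      rewrite Qp by auto.
      assert (H1 : sgn (sigma j) * sgn (sigma j) = 1) by (unfold sgn; destruct (sigma j); ring).
      assert (Hsd : 0 < s * d) by (apply Rmult_lt_0_compat; auto).
      destruct (Req_dec (Q h (F j)) 0) as [E|E].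
      * rewrite E. assert (H : 0 < sgn (sigma j) * ((1 - s) * 0 + s * (d * sgn (sigma j)))).
        { replace (sgn (sigma j) * ((1 - s) * 0 + s * (d * sgn (sigma j))))
            with (s * d * (sgn (sigma j) * sgn (sigma j))) by ring. rewrite H1; lra. }
        split; [|auto]. intros E'. rewrite E' in H. lra.
      * split; [|intros; contradiction]. specialize (Hxj j Hj E).
        assert (Hsx : s * d <= x * d) by (apply Rmult_le_compat_r; lra).
        intros E'. assert (Ea : Rabs ((1 - s) * Q h (F j)) = Rabs (s * d * sgn (sigma j))).
        { replace ((1 - s) * Q h (F j)) with (- (s * d * sgn (sigma j))) by lra.
          apply Rabs_Ropp. }
        assert (Eg : Rabs (sgn (sigma j)) = 1).
        { unfold sgn; destruct (sigma j); [apply Rabs_R1|]. rewrite Rabs_left; lra. }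
        rewrite !Rabs_mult, Eg, (Rabs_right (1 - s)), (Rabs_right s), (Rabs_right d) in Ea by lra.
        assert (1 / 2 * Rabs (Q h (F j)) <= (1 - s) * Rabs (Q h (F j))).
        { apply Rmult_le_compat_r; [apply Rabs_pos|lra]. }
        lra.
Qed.

Lemma Rmult_pos_close q q' c :
  0 < c * q -> Rabs (q' - q) < Rabs q -> 0 < c * q'.
Proof.
  intros H1 H2. destruct (Rlt_le_dec 0 c) as [Hc|Hc].
  - assert (0 < q) by (apply (Rmult_lt_reg_l c); lra).
    rewrite (Rabs_right q) in H2 by lra. apply Rabs_lt_between in H2.
    apply Rmult_lt_0_compat; lra.
  - assert (c < 0) by (destruct Hc as [|E]; [auto|rewrite E in H1; lra]).
    assert (q < 0). { apply (Rmult_lt_reg_l (- c)); lra. }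
    rewrite (Rabs_left q) in H2 by lra. apply Rabs_lt_between in H2.
    replace (c * q') with (- c * - q') by ring. apply Rmult_lt_0_compat; lra.
Qed.

(* An even [w] orthogonal to all [evenpart (F k)] detects the new member: any
   [g] with [int w g <> 0] has its even part outside their span. *)
Lemma extension_step F n h eps sigma :
  (forall k, (k < n)%nat -> inG0 (F k)) -> indep (fun k => evenpart (F k)) n ->
  inG0 h -> 0 < eps ->
  exists g, inG0 g /\ (forall t, in_I t -> Rabs (h t - g t) <= eps) /\
    indep (fun k => evenpart (extend n F g k)) (S n) /\
    forall j, (j < n)%nat ->
      Q g (F j) <> 0 /\ (Q h (F j) = 0 -> 0 < sgn (sigma j) * Q g (F j)).
Proof.
  intros HF Hi Hh Heps.
  destruct (perturb_signs F n h (eps / 2) sigma HF Hi Hh ltac:(lra))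
    as (g0 & s & Hs & Hg0 & Dg0 & Sg0 & Qg0).
  pose proof Hg0 as [Gg0 Ig0].
  (* Orthogonality to the constant 1 keeps the perturbed map at mean zero. *)
  set (phi := fun k => match k with O => fun _ : R => 1 | S j => evenpart (F j) end).
  destruct (bumps_orthogonal phi (S n)) as (e & [He1 [He2 _]] & He3).
  { intros [|k] Hk; [apply cont_on_I_const|]. apply evenpart_cont, inG_cont, HF. lia. }
  pose proof (He1 O) as Ew. destruct (He2 O) as [t0 [Ht0 Hw0]].
  set (w := e O) in *. assert (Cw : cont_on_I w) by (apply even_lip_cont, Ew).
  assert (Iw : Int w = 0).
  { rewrite <- (He3 O O) by lia. apply Int_ext; intros; simpl; unfold w; ring. }
  assert (Ow : forall k, (k < n)%nat -> Int (fun t => w t * evenpart (F k) t) = 0).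
  { intros k Hk. apply (He3 O (S k)). lia. }
  clearbody w. clear e He1 He2 He3.
  destruct Ew as [[L HL] [w1 weven]].
  destruct (cont_on_I_bounded w Cw) as [W [HW BW]].
  destruct (finite_lower n (fun j x => 2 * (x * W) < Rabs (Q g0 (F j)))) as [x [Hx Hxj]].
  { intros j x y [Hx Hxy] H. apply Rle_lt_trans with (2 := H).
    assert (x * W <= y * W) by (apply Rmult_le_compat_r; lra). lra. }
  { intros j Hj. destruct (Qg0 j Hj) as [Hne _]. apply Rabs_pos_lt in Hne.
    exists (Rabs (Q g0 (F j)) / (4 * W)). split; [apply Rdiv_lt_0_compat; lra|].
    replace (2 * (Rabs (Q g0 (F j)) / (4 * W) * W)) with (Rabs (Q g0 (F j)) / 2) by (field; lra).
    lra. }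
  assert (HLpos : exists L', 0 < L' /\ L <= L').
  { exists (Rmax L 1). split; [|apply Rmax_l]. apply Rlt_le_trans with 1; [lra|apply Rmax_r]. }
  destruct HLpos as [L' [HL' HLL']].
  (* The three bounds preserve the signs of [Q], monotonicity and the distance to [h]. *)
  set (eta1 := Rmin x (Rmin (s / (2 * L')) (eps / (2 * W)))).
  assert (Heta1 : 0 < eta1).
  { repeat apply Rmin_pos; auto; apply Rdiv_lt_0_compat; lra. }
  assert (Hb : eta1 <= x /\ eta1 <= s / (2 * L') /\ eta1 <= eps / (2 * W)).
  { unfold eta1, Rmin; repeat destruct Rle_dec; lra. }
  destruct Hb as [Hb1 [Hb2 Hb3]].
  assert (Hb2' : eta1 * L' <= s / 2).
  { apply (Rmult_le_compat_r L') in Hb2; [|lra].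
    replace (s / (2 * L') * L') with (s / 2) in Hb2 by (field; lra). exact Hb2. }
  assert (Hb3' : eta1 * W <= eps / 2).
  { apply (Rmult_le_compat_r W) in Hb3; [|lra].
    replace (eps / (2 * W) * W) with (eps / 2) in Hb3 by (field; lra). exact Hb3. }
  assert (Cg0 := inG_cont _ Gg0). assert (Ceg0 := evenpart_cont _ Cg0).
  set (A := Int (fun t => w t * evenpart g0 t)). set (D := Int (fun t => w t * w t)).
  assert (HD : 0 < D) by (apply (Int_sq_pos w t0); auto).
  (* The integral of [w] against the even part of [g0 + eta * w] is [A + eta * D]. It has at most
     one zero in [eta], so [eta1] or its half works. *)
  assert (Heta : exists eta, 0 < eta <= eta1 /\ A + eta * D <> 0).
  { destruct (Req_dec (A + eta1 * D) 0) as [E|E]; [|exists eta1; split; [lra|exact E]].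
    exists (eta1 / 2); split; [lra|]. intros E'.
    assert (0 < eta1 * D) by (apply Rmult_lt_0_compat; auto). lra. }
  destruct Heta as [eta [[Heta Hle] HA]].
  assert (Hx' : eta * W <= x * W) by (apply Rmult_le_compat_r; lra).
  assert (HW' : eta * W <= eta1 * W) by (apply Rmult_le_compat_r; lra).
  assert (HL1 : eta * L' <= eta1 * L') by (apply Rmult_le_compat_r; lra).
  set (g := fun t => g0 t + eta * w t).
  assert (Cg : cont_on_I g) by (unfold g; cont_I).
  assert (Dg : forall t, in_I t -> Rabs (g t - g0 t) <= eta * W).
  { intros t Ht. replace (g t - g0 t) with (eta * w t) by (unfold g; ring).
    rewrite Rabs_mult, (Rabs_right eta) by lra. apply Rmult_le_compat_l; [lra|auto]. }
  assert (Gg : inG g).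
  { destruct Gg0 as (_ & _ & _ & E1 & E2). apply inG_intro; auto.
    - intros a b Ha Hb Hab. specialize (Sg0 a b Ha Hb Hab). specialize (HL a b Ha Hb).
      rewrite (Rabs_right (b - a)) in HL by lra. apply Rabs_le_between in HL.
      assert (H1 : eta * (L * (b - a)) <= s / 2 * (b - a)).
      { replace (eta * (L * (b - a))) with (eta * L * (b - a)) by ring.
        apply Rmult_le_compat_r; [lra|]. apply Rle_trans with (eta * L'); [|lra].
        apply Rmult_le_compat_l; lra. }
      assert (H2 : eta * (- (L * (b - a))) <= eta * (w b - w a)) by (apply Rmult_le_compat_l; lra).
      assert (0 < s * (b - a)) by (apply Rmult_lt_0_compat; lra).
      unfold g. lra.
    - unfold g. replace (-1) with (- (1)) by ring. rewrite weven, w1.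
      replace (- (1)) with (-1) by ring. rewrite E1; ring.
    - unfold g. rewrite w1, E2; ring. }
  exists g. split; [split; [exact Gg|]|split; [|split]].
  - change (Int g = 0). unfold g. rewrite Int_plus, Int_scal, Iw by cont_I.
    unfold Int; rewrite Ig0; ring.
  - intros t Ht. specialize (Dg0 t Ht). specialize (Dg t Ht).
    replace (h t - g t) with ((h t - g0 t) - (g t - g0 t)) by ring.
    eapply Rle_trans; [apply Rabs_triang|]. rewrite Rabs_Ropp. lra.
  - apply indep_S_intro.
    + apply indep_ext with (2 := Hi). intros k t Hk _. rewrite extend_lt; auto.
    + intros c Hc.
      (* Integrating the relation against [w] leaves only [c n * (A + eta * D)]. *)
      assert (E : Int (fun t => lc c (fun k => evenpart (extend n F g k)) (S n) t * w t) = 0).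
      { rewrite (Int_ext _ (fun _ => 0)); [rewrite Int_const; ring|].
        intros t Ht. rewrite Hc; auto; ring. }
      assert (Ce : forall k, (k < S n)%nat -> cont_on_I (evenpart (extend n F g k))).
      { intros k Hk. apply evenpart_cont. destruct (Nat.eq_dec k n) as [->|Hne].
        - rewrite extend_eq; auto.
        - rewrite extend_lt by lia. apply inG_cont, HF; lia. }
      rewrite Int_lc_mult in E by auto. simpl in E. rewrite lsum_0 in E.
      * rewrite extend_eq in E.
        rewrite (Int_ext _ (fun t => w t * evenpart g0 t + eta * (w t * w t))) in E.
        -- rewrite Int_plus, Int_scal in E by cont_I. fold A D in E. rewrite Rplus_0_l in E.
           apply Rmult_integral in E. tauto.
        -- intros t Ht. unfold evenpart, g. rewrite weven. field.
      * intros k Hk. rewrite extend_lt by auto.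
        rewrite (Int_ext _ (fun t => w t * evenpart (F k) t)) by (intros; ring).
        rewrite Ow by auto. ring.
  - intros j Hj. destruct (Qg0 j Hj) as [Hne Hsg]. specialize (Hxj j Hj).
    assert (HQ : Rabs (Q g (F j) - Q g0 (F j)) < Rabs (Q g0 (F j))).
    { eapply Rle_lt_trans; [apply (Q_lip_l g g0 (F j) (eta * W)); auto; apply HF; auto|]. lra. }
    split.
    + intros E. rewrite E, Rminus_0_l, Rabs_Ropp in HQ. lra.
    + intros E. apply (Rmult_pos_close (Q g0 (F j))); auto.
Qed.

(** * Universal tournaments *)

(* [Nat.testbit c] encodes an arbitrary prescription on [0, ..., m - 1]. *)
Definition extension_prop (U : nat -> nat -> Prop) : Prop :=
  forall m c, exists v, forall a, (a < m)%nat ->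
    if Nat.testbit c a then U a v else U v a.

(** Coding finite patterns by numbers makes the prescriptions countable, as both the G_delta form
    and the density construction require. *)
Lemma testbit_prescribed (P : nat -> Prop) m :
  exists c, forall a, (a < m)%nat -> (Nat.testbit c a = true <-> P a).
Proof.
  induction m as [|m [c Hc]]; [exists O; lia|].
  destruct (classic (P m)) as [HP|HP].
  - exists (Nat.setbit c m). intros a Ha. rewrite Nat.setbit_eqb.
    destruct (Nat.eqb_spec m a) as [<-|Hne]; simpl; [tauto|]. apply Hc; lia.
  - exists (Nat.clearbit c m). intros a Ha. rewrite Nat.clearbit_eqb.
    destruct (Nat.eqb_spec m a) as [<-|Hne]; simpl.
    + rewrite Bool.andb_false_r. split; [discriminate|contradiction].
    + rewrite Bool.andb_true_r. apply Hc; lia.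
Qed.

(** Add one vertex [None] to [U], joined to the others as [c] dictates, and extend the identity
    embedding of the first [m] vertices. The image of [None] is the vertex sought. *)
Lemma universal_extension U : is_tournament U -> universal_prop U -> extension_prop U.
Proof.
  intros (T1 & T2 & T3) HU m c.
  set (Rl := fun x y : option nat =>
    match x, y with
    | Some a, Some b => U a b
    | Some a, None => Nat.testbit c a = true
    | None, Some b => Nat.testbit c b = false
    | None, None => False
    end).
  destruct (HU (option nat) Rl) with (S0 := map Some (seq 0 m))
    (phi := fun x => match x with Some a => a | None => O end) as (psi & Hinj & Hemb & Hext).
  - exists (fun x => match x with Some a => S a | None => O end).
    intros [a|] [b|] E; congruence.
  - split; [|split].
    + intros [a|] H; simpl in H; [exact (T1 a H)|exact H].
    + intros [a|] [b|] H; simpl.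
      * apply T2; congruence.
      * destruct (Nat.testbit c a); auto.
      * destruct (Nat.testbit c b); auto.
      * congruence.
    + intros [a|] [b|] H; simpl in *; try congruence; auto.
  - intros x y Hx Hy. apply in_map_iff in Hx as [a [<- _]]. apply in_map_iff in Hy as [b [<- _]].
    congruence.
  - intros x y Hx Hy. apply in_map_iff in Hx as [a [<- _]]. apply in_map_iff in Hy as [b [<- _]].
    reflexivity.
  - exists (psi None). intros a Ha.
    assert (Ea : psi (Some a) = a).
    { apply (Hext (Some a)), in_map, in_seq. lia. }
    destruct (Nat.testbit c a) eqn:E.
    + rewrite <- Ea at 1. apply Hemb. exact E.
    + rewrite <- Ea. apply Hemb. exact E.
Qed.

(** A finite partial map given by its graph; the equivalence of the two equalities makes it
    single-valued and injective. *)
Definition partial_embedding {X : Type} (Rl : X -> X -> Prop) (U : nat -> nat -> Prop)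
    (l : list (X * nat)) : Prop :=
  forall x v y w, In (x, v) l -> In (y, w) l -> (x = y <-> v = w) /\ (Rl x y <-> U v w).

Lemma partial_embedding_step {X : Type} (Rl : X -> X -> Prop) U l x :
  is_tournament Rl -> is_tournament U -> extension_prop U -> partial_embedding Rl U l ->
  exists l', partial_embedding Rl U l' /\ incl l l' /\ exists v, In (x, v) l'.
Proof.
  intros (R1 & R2 & R3) (T1 & T2 & T3) HU Hl.
  destruct (classic (exists v, In (x, v) l)) as [Hx|Hx].
  { exists l; split; [exact Hl|split; [apply incl_refl|exact Hx]]. }
  (* All values used so far lie below [m], so the extension property controls every arrow to the new
     vertex. Irreflexivity of [U] makes that vertex new. *)
  set (m := S (list_max (map snd l))).
  assert (Hm : forall y a, In (y, a) l -> (a < m)%nat).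
  { intros y a H. pose proof (list_max_le (map snd l) (list_max (map snd l))) as [A _].
    specialize (A (le_n _)). rewrite Forall_forall in A. unfold m.
    specialize (A a (in_map snd _ _ H)). lia. }
  destruct (testbit_prescribed (fun a => exists y, In (y, a) l /\ Rl y x) m) as [c Hc].
  destruct (HU m c) as [v Hv].
  assert (Hn : forall y a, In (y, a) l -> y <> x /\ a <> v /\ (Rl y x <-> U a v) /\ (Rl x y <-> U v a)).
  { intros y a Hy. specialize (Hv a (Hm y a Hy)). specialize (Hc a (Hm y a Hy)).
    assert (Hyx : y <> x) by (intros ->; eauto).
    destruct (Nat.testbit c a).
    - destruct Hc as [Hc _]. destruct (Hc eq_refl) as [y' [Hy' Hr]].
      assert (y' = y) as -> by (apply (Hl y' a y a Hy' Hy); reflexivity).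
      split; [exact Hyx|split; [intros ->; exact (T1 _ Hv)|]].
      split; (split; intros H; auto); exfalso; [exact (R3 _ _ Hr H)|exact (T3 _ _ Hv H)].
    - assert (Hr : Rl x y).
      { destruct (R2 x y) as [H|H]; auto. exfalso.
        assert (false = true) by (apply Hc; eauto). discriminate. }
      split; [exact Hyx|split; [intros ->; exact (T1 _ Hv)|]].
      split; (split; intros H; auto); exfalso; [exact (R3 _ _ Hr H)|exact (T3 _ _ Hv H)]. }
  exists ((x, v) :: l). split; [|split; [apply incl_tl, incl_refl|exists v; left; reflexivity]].
  intros y1 a1 y2 a2 [E1|H1] [E2|H2].
  - injection E1 as <- <-. injection E2 as <- <-. split; [tauto|].
    split; intros H; exfalso; [exact (R1 _ H)|exact (T1 _ H)].
  - injection E1 as <- <-. destruct (Hn y2 a2 H2) as (A & B & C & D).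
    split; [split; intros; congruence|exact D].
  - injection E2 as <- <-. destruct (Hn y1 a1 H1) as (A & B & C & D).
    split; [split; intros; congruence|exact C].
  - apply Hl; auto.
Qed.

(** The forth half of a back-and-forth argument: starting from the graph of [phi] on [S0], stage [n]
    adds the element with code [n], and [psi] is the union of the stages. *)
Lemma extension_universal U : is_tournament U -> extension_prop U -> universal_prop U.
Proof.
  intros HT HU S Rl [enc Henc] HR S0 phi Hinj Hemb.
  set (good := partial_embedding Rl U).
  (* Placing [good l] under the existential lets choice yield a step function defined on all
     lists. *)
  assert (Hstep : forall l n, exists l', good l ->
    good l' /\ incl l l' /\ forall x, enc x = n -> exists v, In (x, v) l').
  { intros l n. destruct (classic (good l)) as [Hl|Hl]; [|exists l; tauto].
    destruct (classic (exists x, enc x = n)) as [[x Hx]|Hno].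
    - destruct (partial_embedding_step Rl U l x HR HT HU Hl) as (l' & H1 & H2 & H3).
      exists l'. intros _; split; [exact H1|split; [exact H2|]].
      intros y Hy. assert (y = x) as -> by (apply Henc; congruence). exact H3.
    - exists l. intros _; split; [exact Hl|split; [apply incl_refl|]].
      intros x Hx. exfalso; eauto. }
  set (nxt := fun l n => proj1_sig (constructive_indefinite_description _ (Hstep l n))).
  assert (Hnxt : forall l n, good l ->
    good (nxt l n) /\ incl l (nxt l n) /\ forall x, enc x = n -> exists v, In (x, v) (nxt l n)).
  { intros l n. unfold nxt. destruct constructive_indefinite_description; auto. }
  set (L := fix L n := match n with
    | O => map (fun x => (x, phi x)) S0 | Datatypes.S k => nxt (L k) k end).
  assert (HL : forall n, good (L n)).
  { induction n as [|n IH]; [|apply Hnxt, IH].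
    intros x v y w Hx Hy. simpl in Hx, Hy.
    apply in_map_iff in Hx as [x' [Ex Hx]]. apply in_map_iff in Hy as [y' [Ey Hy]].
    injection Ex as <- <-. injection Ey as <- <-.
    split; [split; [congruence|auto]|auto]. }
  assert (Hmon : forall n k, (n <= k)%nat -> incl (L n) (L k)).
  { intros n k H. induction H as [|k H IH]; [apply incl_refl|].
    apply (incl_tran IH). apply Hnxt, HL. }
  assert (Hdef : forall x, exists v, In (x, v) (L (Datatypes.S (enc x)))).
  { intros x. apply (Hnxt (L (enc x)) (enc x) (HL _)). reflexivity. }
  set (psi := fun x => proj1_sig (constructive_indefinite_description _ (Hdef x))).
  assert (Hpsi : forall x, In (x, psi x) (L (Datatypes.S (enc x)))).
  { intros x. unfold psi. destruct constructive_indefinite_description; auto. }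
  assert (Hcommon : forall x y, exists n, In (x, psi x) (L n) /\ In (y, psi y) (L n)).
  { intros x y. exists (Nat.max (Datatypes.S (enc x)) (Datatypes.S (enc y))).
    split; (eapply Hmon; [|apply Hpsi]); lia. }
  exists psi. split; [|split].
  - intros x y E. destruct (Hcommon x y) as [n [Hx Hy]].
    apply (HL n _ _ _ _ Hx Hy), E.
  - intros x y. destruct (Hcommon x y) as [n [Hx Hy]]. apply (HL n _ _ _ _ Hx Hy).
  - intros x Hx. symmetry.
    apply (HL (Datatypes.S (enc x)) x (phi x) x (psi x)); auto.
    apply (Hmon O); [lia|]. apply in_map_iff. eauto.
Qed.

(** Only strict inequalities on [Q] under countable quantifiers remain, so the G_delta form can be
    read off. Antisymmetry of [Q] supplies irreflexivity and asymmetry of the digraph. *)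
Lemma UTOUR_iff F : G0seq F ->
  (UTOUR F <->
   (forall i j, i = j \/ Q (F j) (F i) > 0 \/ Q (F i) (F j) > 0) /\
   (forall m c, exists v, forall a, (a < m)%nat ->
      if Nat.testbit c a then Q (F v) (F a) > 0 else Q (F a) (F v) > 0)).
Proof.
  intros HF. assert (HG : forall k, inG (F k)) by (intros; apply HF).
  split.
  - intros [_ [HT HU]]. split.
    + intros i j. destruct (Nat.eq_dec i j) as [|Hne]; auto. right. apply HT, Hne.
    + apply (universal_extension _ HT HU).
  - intros [H1 H2]. assert (HT : is_tournament (Udig F)).
    { split; [|split]; unfold Udig.
      - intros i. rewrite Q_diag by auto. lra.
      - intros i j Hne. destruct (H1 i j); tauto.
      - intros i j. rewrite (Q_antisym (F i) (F j)) by auto. lra. }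
    split; [exact HF|split; [exact HT|]]. apply extension_universal; auto.
Qed.

(** * G_delta sets *)

Lemma nbhd_weaken F N eps F' N' eps' :
  (N' <= N)%nat -> eps <= eps' -> nbhd F N eps F' -> nbhd F N' eps' F'.
Proof.
  intros H1 H2 H k Hk. destruct (H k ltac:(lia)) as [d [Hd Hd']].
  exists d; split; [lra|auto].
Qed.

Lemma open_and A B : open_G0N A -> open_G0N B -> open_G0N (fun F => A F /\ B F).
Proof.
  intros HA HB F HF [H1 H2].
  destruct (HA F HF H1) as (N1 & e1 & He1 & P1). destruct (HB F HF H2) as (N2 & e2 & He2 & P2).
  exists (Nat.max N1 N2), (Rmin e1 e2). split; [apply Rmin_pos; auto|].
  intros F' HF' Hn. split; [apply P1|apply P2]; auto;
    (eapply nbhd_weaken; [| |exact Hn]; [lia|auto using Rmin_l, Rmin_r]).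
Qed.

Lemma open_exists {T} (A : T -> (nat -> R -> R) -> Prop) :
  (forall x, open_G0N (A x)) -> open_G0N (fun F => exists x, A x F).
Proof.
  intros H F HF [x Hx]. destruct (H x F HF Hx) as (N & e & He & P).
  exists N, e; split; eauto.
Qed.

Lemma open_forall_lt (A : nat -> (nat -> R -> R) -> Prop) m :
  (forall a, open_G0N (A a)) -> open_G0N (fun F => forall a, (a < m)%nat -> A a F).
Proof.
  intros H. induction m as [|m IH].
  - intros F _ _. exists O, 1. split; [lra|]. lia.
  - intros F HF HA.
    destruct (open_and _ _ IH (H m) F HF) as (N & e & He & P); [split; auto|].
    exists N, e; split; auto. intros F' HF' Hn a Ha. destruct (P F' HF' Hn) as [P1 P2].
    destruct (Nat.eq_dec a m) as [->|Hne]; [exact P2|apply P1; lia].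
Qed.

Lemma open_const P : open_G0N (fun _ => P).
Proof. intros F _ H. exists O, 1; split; [lra|auto]. Qed.

Lemma open_or A B : open_G0N A -> open_G0N B -> open_G0N (fun F => A F \/ B F).
Proof.
  intros HA HB F HF [H|H].
  - destruct (HA F HF H) as (N & e & He & P). exists N, e; split; auto.
  - destruct (HB F HF H) as (N & e & He & P). exists N, e; split; auto.
Qed.

Lemma open_Q_pos i j : open_G0N (fun F => Q (F j) (F i) > 0).
Proof.
  (* By [Q_lip] the value then changes by less than half of itself. *)
  intros F HF H. exists (S (Nat.max i j)), (Q (F j) (F i) / 8). split; [lra|].
  intros F' HF' Hn. destruct (Hn i ltac:(lia)) as [d1 [Hd1 E1]].
  destruct (Hn j ltac:(lia)) as [d2 [Hd2 E2]].
  assert (HQ : Rabs (Q (F j) (F i) - Q (F' j) (F' i)) <= 4 * Rmax d1 d2).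
  { apply Q_lip; try (apply HF); try (apply HF').
    - intros t Ht. eapply Rle_trans; [apply E2, Ht|apply Rmax_r].
    - intros t Ht. eapply Rle_trans; [apply E1, Ht|apply Rmax_l]. }
  assert (Rmax d1 d2 < Q (F j) (F i) / 8) by (apply Rmax_lub_lt; auto).
  apply Rabs_le_between in HQ. lra.
Qed.

(** Stated for a family [h F] depending on [F] in a 1-Lipschitz way, to cover both the sequence with
    the identity prepended and the even parts. As [h F k] looks only at indices up to [k], the first
    [n] coordinates suffice. *)
Lemma open_indep (h : (nat -> R -> R) -> nat -> R -> R) n :
  (forall F k, G0seq F -> cont_on_I (h F k)) ->
  (forall F F' k d, (forall j t, (j <= k)%nat -> in_I t -> Rabs (F j t - F' j t) <= d) ->
     0 <= d -> forall t, in_I t -> Rabs (h F k t - h F' k t) <= d) ->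
  open_G0N (fun F => indep (h F) n).
Proof.
  intros Hc Hl F HF Hi.
  destruct (indep_stable (h F) n ltac:(auto) Hi) as (eps & Heps & H).
  exists n, eps. split; [exact Heps|]. intros F' HF' Hn. apply H; auto.
  intros k t Hk Ht. apply Hl; auto; [|lra].
  intros j s Hj Hs. destruct (Hn j ltac:(lia)) as [d [Hd E]]. specialize (E s Hs). lra.
Qed.

Definition is_Gdelta (A : (nat -> R -> R) -> Prop) : Prop :=
  exists B : nat -> (nat -> R -> R) -> Prop,
    (forall n, open_G0N (B n)) /\ forall F, G0seq F -> (A F <-> forall n, B n F).

Lemma Gdelta_open A : open_G0N A -> is_Gdelta A.
Proof.
  intros H. exists (fun _ => A). split; auto. intros F _. split; auto. intros H'; exact (H' O).
Qed.

(** Choose a sequence of open sets for each [n] and enumerate the double sequence by Cantor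
    pairing. *)
Lemma Gdelta_forall (A : nat -> (nat -> R -> R) -> Prop) :
  (forall n, is_Gdelta (A n)) -> is_Gdelta (fun F => forall n, A n F).
Proof.
  intros H. set (B := fun n => proj1_sig (constructive_indefinite_description _ (H n))).
  assert (HB : forall n, (forall k, open_G0N (B n k)) /\
    forall F, G0seq F -> (A n F <-> forall k, B n k F)).
  { intros n. unfold B. destruct constructive_indefinite_description; auto. }
  exists (fun k => B (fst (of_nat k)) (snd (of_nat k))). split; [intros; apply HB|].
  intros F HF. split.
  - intros HA k. apply (proj1 (proj2 (HB _) F HF) (HA _)).
  - intros Hk n. apply (proj2 (HB n) F HF). intros k.
    specialize (Hk (to_nat (n, k))). rewrite cancel_of_to in Hk. exact Hk.
Qed.

Lemma Gdelta_and A B : is_Gdelta A -> is_Gdelta B -> is_Gdelta (fun F => A F /\ B F).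
Proof.
  intros HA HB.
  destruct (Gdelta_forall (fun n => match n with O => A | _ => B end)) as [C [HC E]].
  { intros [|n]; auto. }
  exists C; split; auto. intros F HF. rewrite <- E by auto. split.
  - intros [H1 H2] [|n]; auto.
  - intros H; split; [apply (H O)|apply (H 1%nat)].
Qed.

Lemma Gdelta_G0N_intro A P :
  (forall F, A F -> G0seq F) -> is_Gdelta P -> (forall F, G0seq F -> (A F <-> P F)) ->
  Gdelta_G0N A.
Proof.
  intros H1 [B [HB E]] H2. split; auto. exists B; split; auto.
  intros F HF. rewrite H2 by auto. auto.
Qed.

Lemma Gdelta_UTOUR : is_Gdelta UTOUR.
Proof.
  assert (H : is_Gdelta (fun F =>
   (forall i j, i = j \/ Q (F j) (F i) > 0 \/ Q (F i) (F j) > 0) /\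
   (forall m c, exists v, forall a, (a < m)%nat ->
      if Nat.testbit c a then Q (F v) (F a) > 0 else Q (F a) (F v) > 0))).
  { apply Gdelta_and.
    - apply Gdelta_forall; intros i. apply Gdelta_forall; intros j. apply Gdelta_open.
      apply open_or; [apply open_const|]. apply open_or; apply open_Q_pos.
    - apply Gdelta_forall; intros m. apply Gdelta_forall; intros c. apply Gdelta_open.
      apply open_exists; intros v. apply open_forall_lt; intros a.
      destruct (Nat.testbit c a); apply open_Q_pos. }
  destruct H as [B [HB E]]. exists B; split; auto.
  intros F HF. rewrite UTOUR_iff by auto. auto.
Qed.

Lemma Gdelta_lin_indep (h : (nat -> R -> R) -> nat -> R -> R) :
  (forall F k, G0seq F -> cont_on_I (h F k)) ->
  (forall F F' k d, (forall j t, (j <= k)%nat -> in_I t -> Rabs (F j t - F' j t) <= d) ->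
     0 <= d -> forall t, in_I t -> Rabs (h F k t - h F' k t) <= d) ->
  is_Gdelta (fun F => lin_indep_I (h F)).
Proof.
  intros Hc Hl.
  destruct (Gdelta_forall (fun n F => indep (h F) (S n))) as [B [HB E]].
  { intros n. apply Gdelta_open, open_indep; auto. }
  exists B; split; auto. intros F HF. rewrite lin_indep_I_indep. auto.
Qed.

Lemma UGENplus_UGEN F : UGENplus F -> UGEN F.
Proof.
  intros [H1 H2]. split; [exact H1|]. rewrite lin_indep_I_indep in *. intros n.
  apply (indep_ext (fun k => with_affine F (S k))).
  - intros [|k] t _ _; reflexivity.
  (* The constant is dropped in front and [F n] at the end. *)
  - apply (indep_tail (with_affine F)), indep_S. apply indep_with_affine; [|apply H2].
    intros; apply H1.
Qed.

(** * Density *)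

(** Dependent choice: [P n] sees only the first [n] terms, which later stages never alter, so the
    diagonal sequence satisfies every [P n]. *)
Lemma sequential_choice (P : nat -> (nat -> R -> R) -> Prop) :
  (forall n F F', (forall k, (k < n)%nat -> F k = F' k) -> P n F -> P n F') ->
  P O (fun _ _ => 0) ->
  (forall n F, P n F -> exists g, P (S n) (extend n F g)) ->
  exists F, forall n, P n F.
Proof.
  intros Hext H0 Hstep.
  set (G := fix G n := match n with
    | O => fun _ _ => 0
    | S n' => extend n' (G n') (epsilon (inhabits (fun _ => 0)) (fun g => P (S n') (extend n' (G n') g)))
    end).
  assert (HG : forall n, P n (G n)).
  { induction n as [|n IH]; [exact H0|]. simpl.
    apply (epsilon_spec (inhabits (fun _ => 0)) (fun g => P (S n) (extend n (G n) g))).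
    apply Hstep, IH. }
  assert (Hstab : forall k n, (k < n)%nat -> G n k = G (S k) k).
  { intros k n H. induction H as [|n H IH]; [reflexivity|].
    rewrite <- IH. simpl. apply extend_lt. lia. }
  exists (fun k => G (S k) k). intros n. apply Hext with (2 := HG n).
  intros k Hk. apply Hstab, Hk.
Qed.

Lemma dense_UGENplus : dense_G0N UGENplus.
Proof.
  intros F HF N eps Heps.
  (* Only the first [N] terms must be approximated; later ones are taken near the identity, where
     all signs can be prescribed. *)
  set (h := fun k => if Nat.ltb k N then F k else fun t => t).
  (* Under Cantor pairing each code [c] is assigned to infinitely many indices [k]. *)
  set (sigma := fun k j => Nat.testbit (fst (of_nat k)) j).
  assert (Hid : inG0 (fun t => t)) by (split; [apply inG_id|exact Int_id]).
  assert (Hh : forall k, inG0 (h k)).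
  { intros k. unfold h. destruct (Nat.ltb k N); auto. }
  set (near := fun (G : nat -> R -> R) k =>
    forall t, in_I t -> Rabs (h k t - G k t) <= eps / 2).
  set (signs := fun (G : nat -> R -> R) k => forall j, (j < k)%nat ->
    Q (G k) (G j) <> 0 /\ (Q (h k) (G j) = 0 -> 0 < sgn (sigma k j) * Q (G k) (G j))).
  destruct (sequential_choice (fun n G =>
    (forall k, (k < n)%nat -> inG0 (G k) /\ near G k /\ signs G k) /\
    indep (fun k => evenpart (G k)) n)) as [G HG].
  - intros n G G' E [H1 H2]. split.
    + intros k Hk. destruct (H1 k Hk) as (A & B & C). unfold near, signs in *.
      rewrite <- (E k Hk). split; [exact A|split; [exact B|]].
      intros j Hj. rewrite <- (E j) by lia. auto.
    + apply indep_ext with (2 := H2). intros k t Hk _. rewrite E; auto.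
  - split; [lia|]. intros c _ k Hk; lia.
  - intros n G [H1 H2].
    destruct (extension_step G n (h n) (eps / 2) (sigma n)) as (g & Hg & Hn & Hi & Hs);
      auto; [intros; apply H1; auto|lra|].
    exists g. split; [|exact Hi]. intros k Hk.
    destruct (Nat.eq_dec k n) as [->|Hne].
    + unfold near, signs. rewrite extend_eq. split; [exact Hg|split; [exact Hn|]].
      intros j Hj. rewrite extend_lt by auto. auto.
    + destruct (H1 k ltac:(lia)) as (A & B & C). unfold near, signs in *.
      rewrite extend_lt by lia. split; [exact A|split; [exact B|]].
      intros j Hj. rewrite extend_lt by lia. auto.
  - assert (HG0 : G0seq G) by (intros k; apply (HG (S k)); lia).
    assert (Hs : forall k, signs G k) by (intros k; apply (HG (S k)); lia).
    exists G. split; [exact HG0|split; [|split]].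
    + intros k Hk. exists (eps / 2). split; [lra|].
      assert (Hn : near G k) by (apply (HG (S k)); lia).
      unfold near, h in Hn. destruct (Nat.ltb_spec k N); [exact Hn|lia].
    + apply UTOUR_iff; auto. split.
      * assert (Hlt : forall i j, (i < j)%nat -> Q (G j) (G i) > 0 \/ Q (G i) (G j) > 0).
        { intros i j Hij. destruct (Hs j i Hij) as [Hne _].
          rewrite (Q_antisym (G i) (G j)) by (apply HG0). lra. }
        intros i j. destruct (Nat.lt_total i j) as [H|[H|H]]; auto.
        right. apply or_comm. auto.
      (* This index carries the code [c] and is at least [N + m]: its target is the identity and
         every [a < m] precedes it. *)
      * intros m c. set (v := to_nat (c, (N + m)%nat)).
        assert (Hv : (N + m <= v)%nat) by (unfold v; pose proof (to_nat_non_decreasing c (N + m)); lia).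
        exists v. intros a Ha. destruct (Hs v a ltac:(lia)) as [_ H].
        assert (Ev : h v = fun t => t) by (unfold h; destruct (Nat.ltb_spec v N); [lia|auto]).
        rewrite Ev, Q_id_l in H by auto. specialize (H eq_refl).
        unfold sigma in H. unfold v in H at 1. rewrite cancel_of_to in H. simpl in H.
        rewrite (Q_antisym (G a) (G v)) by (apply HG0).
        destruct (Nat.testbit c a); simpl in H; lra.
    + apply lin_indep_I_indep. intros n. apply HG.
Qed.

Theorem theorem5p12 :
  dense_Gdelta_G0N UTOUR /\ dense_Gdelta_G0N UGEN /\ dense_Gdelta_G0N UGENplus.
Proof.
  assert (Hd : forall A, (forall F, UGENplus F -> A F) -> dense_G0N A).
  { intros A HA F HF N eps Heps.
    destruct (dense_UGENplus F HF N eps Heps) as (F' & H1 & H2 & H3). eauto. }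
  split; [|split]; split.
  - apply Hd. intros F H; apply H.
  - apply Gdelta_G0N_intro with UTOUR; [intros F H; apply H|apply Gdelta_UTOUR|tauto].
  - apply Hd, UGENplus_UGEN.
  - apply Gdelta_G0N_intro with UGEN; [intros F H; apply H| |tauto].
    apply Gdelta_and; [apply Gdelta_UTOUR|].
    apply (Gdelta_lin_indep (fun F k => match k with O => fun t => t | S m => F m end)).
    + intros F [|k] HF; [apply cont_on_I_id|apply HF].
    + intros F F' [|k] d H Hpos t Ht; [|apply H; auto].
      unfold Rminus; rewrite Rplus_opp_r, Rabs_R0; exact Hpos.
  - apply Hd; auto.
  - apply Gdelta_G0N_intro with UGENplus; [intros F H; apply H| |tauto].
    apply Gdelta_and; [apply Gdelta_UTOUR|].
    apply (Gdelta_lin_indep (fun F k => evenpart (F k))).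
    + intros F k HF. apply evenpart_cont, HF.
    + intros F F' k d H Hpos t Ht. unfold evenpart.
      pose proof (H k t (le_n _) Ht) as A. pose proof (H k (- t) (le_n _) (in_I_opp t Ht)) as B.
      apply Rabs_le_between in A. apply Rabs_le_between in B. apply Rabs_le. lra.
Qed.
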